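(* Let $\mathfrak{A}=\bigoplus_{i=1}^{k}M_{n_i}(\mathbb{C})$ be a finite-dimensional complex $C^\ast$-algebra (every finite-dimensional complex $C^\ast$-algebra is $\ast$-isomorphic to one of this form), and assume that $\mathfrak{A}$ is not isomorphic to $\mathbb{C}$, $\mathbb{C}\oplus\mathbb{C}$ or $M_2(\mathbb{C})$. Let $\Phi\colon\mathfrak{A}\to\mathfrak{A}$ be an additive surjection. Then the following are equivalent: (i) $\Phi$ preserves mutual strong Birkhoff--James orthogonality (in one direction), i.e. for all $a,b\in\mathfrak{A}$, if $a$ and $b$ are mutually strong Birkhoff--James orthogonal, then so are $\Phi(a)$ and $\Phi(b)$. (ii) There exist a permutation $\pi$ of the minimal ideals of $\mathfrak{A}$ which respects their dimension, a positive scalar $\gamma$, unitary elements $u,v\in\mathfrak{A}$, and a map $x\mapsto x^\dagger$ on $\mathfrak{A}$ which is the identity on some (possibly none) of the minimal ideals and entrywise complex conjugation with respect to a fixed orthonormal basis on the other minimal ideals, such that $$\Phi(a)=\gamma\, u\,\pi(a)^\dagger\, v\qquad\text{for all } a\in\mathfrak{A}.$$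
   Context: For elements $a,b$ of a $C^\ast$-algebra $\mathfrak{A}$, $a$ is strong Birkhoff--James orthogonal to $b$ if $\|a+bc\|\ge\|a\|$ for all $c\in\mathfrak{A}$. The elements $a$ and $b$ are mutually strong Birkhoff--James orthogonal if $a$ is strong Birkhoff--James orthogonal to $b$ and $b$ is strong Birkhoff--James orthogonal to $a$. The $C^\ast$-norm on $\bigoplus_{i=1}^k M_{n_i}(\mathbb{C})$ is $\|A_1\oplus\dots\oplus A_k\|=\max_i\|A_i\|$ with the operator norm on each block. The minimal ideals of $\mathfrak{A}$ are its blocks $M_{n_i}(\mathbb{C})$. A permutation $\pi$ of $\{1,\dots,k\}$ with $n_{\pi(i)}=n_i$ for all $i$ (a permutation respecting dimensions) induces the linear bijection of $\mathfrak{A}$, again denoted $\pi$, given by $\bigoplus A_i\mapsto\bigoplus A_{\pi(i)}$. The map $\dagger$ acts blockwise: $(A_1\oplus\dots\oplus A_k)^\dagger=A_1^\dagger\oplus\dots\oplus A_k^\dagger$, where for each $i$ either $A_i^\dagger=A_i$ for all $A_i$, or $A_i^\dagger=\overline{A_i}$ (entrywise complex conjugate in the fixed orthonormal basis of $\mathbb{C}^{n_i}$) for all $A_i$. Additive means $\Phi(a+b)=\Phi(a)+\Phi(b)$. *)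

(* Defs.v *)
From HB Require Import structures.
From mathcomp Require Import all_boot all_order all_algebra all_fingroup.
From mathcomp Require Import spectral complex.
From mathcomp Require Import all_classical all_reals.

Set Implicit Arguments.
Unset Strict Implicit.
Unset Printing Implicit Defensive.

Import Order.TTheory GRing.Theory Num.Theory.

Local Open Scope ring_scope.
Local Open Scope sesquilinear_scope.

(* The direct sum of the matrix algebras M_(n i) over R[i]. *)
Definition dsum (R : realType) (k : nat) (n : 'I_k -> nat) : Type :=
  {dffun forall i : 'I_k, 'M[R[i]]_(n i)}.

Section DirectSum.
Variables (R : realType) (k : nat) (n : 'I_k -> nat).
Implicit Types (a b c : dsum R n) (z : R[i]).

HB.instance Definition _ := Choice.copy (dsum R n)
  {dffun forall i : 'I_k, 'M[R[i]]_(n i)}.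

Definition block a (i : 'I_k) : 'M[R[i]]_(n i) :=
  (a : {dffun forall i : 'I_k, 'M[R[i]]_(n i)}) i.

Definition mkdsum (F : forall i : 'I_k, 'M[R[i]]_(n i)) : dsum R n :=
  [ffun i : 'I_k => F i : 'M[R[i]]_(n i)].

Lemma blockE F i : block (mkdsum F) i = F i.
Proof. by rewrite /block ffunE. Qed.

Lemma dsumP a b : (forall i, block a i = block b i) -> a = b.
Proof. by move=> eq_ab; apply/ffunP. Qed.

Definition dsum_zero := mkdsum (fun=> 0).
Definition dsum_opp a := mkdsum (fun i => - block a i).
Definition dsum_add a b := mkdsum (fun i => block a i + block b i).
Definition dsum_one := mkdsum (fun=> 1%:M).
Definition dsum_mul a b := mkdsum (fun i => block a i *m block b i).
Definition dsum_scale z a := mkdsum (fun i => z *: block a i).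

Fact dsum_addA : associative dsum_add.
Proof. by move=> a b c; apply: dsumP => i; rewrite !blockE addrA. Qed.
Fact dsum_addC : commutative dsum_add.
Proof. by move=> a b; apply: dsumP => i; rewrite !blockE addrC. Qed.
Fact dsum_add0 : left_id dsum_zero dsum_add.
Proof. by move=> a; apply: dsumP => i; rewrite !blockE add0r. Qed.
Fact dsum_addN : left_inverse dsum_zero dsum_opp dsum_add.
Proof. by move=> a; apply: dsumP => i; rewrite !blockE addNr. Qed.

HB.instance Definition _ := GRing.isZmodule.Build (dsum R n)
  dsum_addA dsum_addC dsum_add0 dsum_addN.

Fact dsum_mulA : associative dsum_mul.
Proof. by move=> a b c; apply: dsumP => i; rewrite !blockE mulmxA. Qed.
Fact dsum_mul1l : left_id dsum_one dsum_mul.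
Proof. by move=> a; apply: dsumP => i; rewrite !blockE mul1mx. Qed.
Fact dsum_mul1r : right_id dsum_one dsum_mul.
Proof. by move=> a; apply: dsumP => i; rewrite !blockE mulmx1. Qed.
Fact dsum_mulDl : left_distributive dsum_mul +%R.
Proof. by move=> a b c; apply: dsumP => i; rewrite !blockE mulmxDl. Qed.
Fact dsum_mulDr : right_distributive dsum_mul +%R.
Proof. by move=> a b c; apply: dsumP => i; rewrite !blockE mulmxDr. Qed.

HB.instance Definition _ := GRing.Zmodule_isPzRing.Build (dsum R n)
  dsum_mulA dsum_mul1l dsum_mul1r dsum_mulDl dsum_mulDr.

Fact dsum_scaleA y z a :
  dsum_scale y (dsum_scale z a) = dsum_scale (y * z) a.
Proof. by apply: dsumP => i; rewrite !blockE scalerA. Qed.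
Fact dsum_scale1 : left_id 1 dsum_scale.
Proof. by move=> a; apply: dsumP => i; rewrite !blockE scale1r. Qed.
Fact dsum_scaleDr : right_distributive dsum_scale +%R.
Proof. by move=> z a b; apply: dsumP => i; rewrite !blockE scalerDr. Qed.
Fact dsum_scaleDl a : {morph dsum_scale^~ a : y z / y + z}.
Proof. by move=> y z; apply: dsumP => i; rewrite !blockE scalerDl. Qed.

HB.instance Definition _ := GRing.Zmodule_isLmodule.Build R[i] (dsum R n)
  dsum_scaleA dsum_scale1 dsum_scaleDr dsum_scaleDl.

(* MathComp's lalgType and algType require a nontrivial ring, and dsum R n is
   trivial when all the n i are 0; hence plain lemmas rather than instances. *)
Lemma dsum_scaleAl z a b : z *: (a * b) = z *: a * b.
Proof. by apply: dsumP => i; rewrite !blockE scalemxAl. Qed.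
Lemma dsum_scaleAr z a b : z *: (a * b) = a * (z *: b).
Proof. by apply: dsumP => i; rewrite !blockE scalemxAr. Qed.

Definition star a : dsum R n := mkdsum (fun i => (block a i)^t*).

Definition unitary a : Prop := star a * a = 1 /\ a * star a = 1.

(* a |-> (A_(pi 0), ..., A_(pi (k - 1))); the casts identify M_(n (pi i))
   with M_(n i). *)
Definition permute (pi : {perm 'I_k}) (dim_pi : forall i, n (pi i) = n i) a :
    dsum R n :=
  mkdsum (fun i => castmx (dim_pi i, dim_pi i) (block a (pi i))).

(* The fixed orthonormal bases are the standard bases. *)
Definition dagger (S : {set 'I_k}) a : dsum R n :=
  mkdsum (fun i => if i \in S then map_mx Num.conj (block a i) else block a i).

End DirectSum.

Definition star_isomorphic (R : realType) (k l : nat)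
    (n : 'I_k -> nat) (m : 'I_l -> nat) : Prop :=
  exists f : {rmorphism dsum R n -> dsum R m},
    [/\ scalable f, bijective f & {morph f : a / star a >-> star a}].

Section Norm.
Local Open Scope classical_set_scope.
Variable R : realType.

Definition l2norm (m : nat) (x : 'cV[R[i]]_m) : R :=
  Num.sqrt (\sum_(i < m) Normc.normc (x i 0) ^+ 2).

Definition opnorm (m : nat) (A : 'M[R[i]]_m) : R :=
  sup [set l2norm (A *m x) | x in [set x : 'cV[R[i]]_m | l2norm x <= 1]].

(* The default value 0 is harmless, operator norms being nonnegative. *)
Definition cstar_norm (k : nat) (n : 'I_k -> nat) (a : dsum R n) : R :=
  \big[Num.max/0]_(i < k) opnorm (block a i).

Definition strong_BJ (k : nat) (n : 'I_k -> nat) (a b : dsum R n) : Prop :=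
  forall c : dsum R n, cstar_norm a <= cstar_norm (a + b * c).

Definition mutual_strong_BJ (k : nat) (n : 'I_k -> nat) (a b : dsum R n) :
    Prop :=
  strong_BJ a b /\ strong_BJ b a.

End Norm.

(* Main.v *)
Require Import Defs.
From mathcomp Require Import all_boot all_order all_algebra all_fingroup.
From mathcomp Require Import complex.
From mathcomp Require Import all_classical all_reals.
From mathcomp Require Import spectral ring.

(** Write the direct sum as the algebra D of block-diagonal matrices in M_N, where
    N is the sum of the n_i; the three excluded algebras are those with N <= 2.
    In D, the element a is strongly orthogonal to b if and only if a attains its
    norm at some y with b^* a y = 0 ([strong_BJ_sorth]). In particular, elements
    with orthogonal ranges are mutually orthogonal.

    Maps of the standard form multiply the norm by a constant and are compatible
    with right multiplication, so they preserve orthogonality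
    ([standard_form_preserves]).

    Conversely, let Phi be an additive surjective preserver, and let E_m be the
    diagonal matrix units. The pieces E_m a of a have orthogonal ranges, so the
    images of complementary partial sums are mutually orthogonal. If Phi a = u is
    unitary, this says that each r_m = Phi (E_m a) u^* and its complement are
    contractions; moreover r_m is nonzero ([preimage_row_neq0]) and then fixes a
    vector. As N such operators add up to 1 in dimension N, they are the
    projections on the lines of an orthonormal basis
    ([resolution_of_identity]). This basis turns out not to depend on a, and since
    unitaries generate D additively there is one unitary X with
    Phi (E_m a) = X E_m X^* Phi a for all a ([intertwine]).

    Thus X^* Phi acts row by row. Orthogonality with suitable rank-two elements
    shows that orthogonal rows of equal length at different places keep these
    properties ([psi_orth_le]), whence the norms of the images of c times a matrix
    unit are proportional to the modulus of c ([psi_norm]); this also supplies the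
    missing continuity. After division by Phi 1, a multiple of a unitary, each
    matrix unit is multiplied by an additive isometry of the complex plane, that
    is by a linear or an antilinear one, and the orthogonality relations between
    rows show that the coefficients come from a diagonal unitary and that the
    conjugations occur blockwise ([om_form]). Altogether Phi a = X a' X^* Phi 1
    where a' is a with some blocks conjugated ([core_form]), and a unitary X for
    which X D X^* lies in D permutes the blocks ([unitary_block_permutation]). *)

Set Implicit Arguments.
Unset Strict Implicit.
Unset Printing Implicit Defensive.

Import Order.TTheory GRing.Theory Num.Theory.
Local Open Scope ring_scope.
Local Open Scope sesquilinear_scope.

Local Notation ev l := (delta_mx l (0 : 'I_1)).
Local Notation er l := (delta_mx (0 : 'I_1) l).

(** * Additive maps *)

Section AdditiveMaps.
Variables (U V : zmodType) (f : U -> V).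
Hypothesis fD : {morph f : x y / x + y}.

Lemma additive_map0 : f 0 = 0.
Proof. by apply: (addrI (f 0)); rewrite -fD !addr0. Qed.

Lemma additive_mapN x : f (- x) = - f x.
Proof. by apply/eqP; rewrite -addr_eq0 -fD addNr additive_map0. Qed.

Lemma additive_mapB x y : f (x - y) = f x - f y.
Proof. by rewrite fD additive_mapN. Qed.

Lemma additive_map_sum (I : finType) (P : pred I) (F : I -> U) :
  f (\sum_(i | P i) F i) = \sum_(i | P i) f (F i).
Proof. exact: (big_morph f fD additive_map0). Qed.

End AdditiveMaps.

(** * The Hilbert-Schmidt form *)

Section Forms.
Variable C : numClosedFieldType.

Section Dot.
Variables p q : nat.
Implicit Types A B : 'M[C]_(p, q).

Definition dot A B : C := \tr (A^t* *m B).
Definition nsq A : C := dot A A.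

Lemma dotE A B : dot A B = \sum_j \sum_i (A i j)^* * B i j.
Proof.
by apply: eq_bigr => j _; rewrite mxE; apply: eq_bigr => i _; rewrite !mxE.
Qed.

Lemma dotDr A B1 B2 : dot A (B1 + B2) = dot A B1 + dot A B2.
Proof. by rewrite /dot mulmxDr linearD. Qed.

Lemma dotNr A B : dot A (- B) = - dot A B.
Proof. by rewrite /dot mulmxN linearN. Qed.

Lemma dotBr A B1 B2 : dot A (B1 - B2) = dot A B1 - dot A B2.
Proof. by rewrite dotDr dotNr. Qed.

Lemma dotZr c A B : dot A (c *: B) = c * dot A B.
Proof. by rewrite /dot -scalemxAr linearZ. Qed.

Lemma dot0r A : dot A 0 = 0.
Proof. by rewrite /dot mulmx0 linear0. Qed.

Lemma dotC A B : dot B A = (dot A B)^*.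
Proof.
rewrite !dotE rmorph_sum; apply: eq_bigr => j _; rewrite rmorph_sum.
by apply: eq_bigr => i _; rewrite rmorphM /= conjCK mulrC.
Qed.

Lemma dot0l A : dot 0 A = 0.
Proof. by rewrite dotC dot0r conjC0. Qed.

Lemma dotDl A1 A2 B : dot (A1 + A2) B = dot A1 B + dot A2 B.
Proof. by rewrite dotC dotDr rmorphD /= -!dotC. Qed.

Lemma dotNl A B : dot (- A) B = - dot A B.
Proof. by rewrite dotC dotNr rmorphN /= -dotC. Qed.

Lemma dotZl c A B : dot (c *: A) B = c^* * dot A B.
Proof. by rewrite dotC dotZr rmorphM /= -dotC. Qed.

Lemma dot_sumr (I : finType) (P : pred I) (F : I -> 'M_(p, q)) A :
  dot A (\sum_(i | P i) F i) = \sum_(i | P i) dot A (F i).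
Proof. by rewrite /dot mulmx_sumr linear_sum. Qed.

Lemma nsqE A : nsq A = \sum_j \sum_i `|A i j| ^+ 2.
Proof.
rewrite /nsq dotE; apply: eq_bigr => j _; apply: eq_bigr => i _.
by rewrite mulrC normCK.
Qed.

Lemma nsq_ge0 A : 0 <= nsq A.
Proof.
rewrite nsqE; apply: sumr_ge0 => j _; apply: sumr_ge0 => i _.
by rewrite exprn_ge0.
Qed.

Lemma nsq_eq0 A : (nsq A == 0) = (A == 0).
Proof.
apply/eqP/eqP => [|->]; last exact: dot0r.
rewrite nsqE => /eqP; rewrite psumr_eq0; last first.
  by move=> j _; apply: sumr_ge0 => i _; rewrite exprn_ge0.
move=> /allP h; apply/matrixP => i j; rewrite mxE.
have := h j (mem_index_enum j); rewrite /= psumr_eq0; last first.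
  by move=> ? _; rewrite exprn_ge0.
move=> /allP /(_ i (mem_index_enum i)) /=.
by rewrite expf_eq0 normr_eq0 => /eqP.
Qed.

Lemma nsq0 : nsq 0 = 0. Proof. exact: dot0r. Qed.

Lemma nsq_gt0 A : (0 < nsq A) = (A != 0).
Proof. by rewrite lt_def nsq_eq0 nsq_ge0 andbT. Qed.

Lemma nsq_real A : (nsq A)^* = nsq A.
Proof. by rewrite /nsq -dotC. Qed.

Lemma nsqZ c A : nsq (c *: A) = `|c| ^+ 2 * nsq A.
Proof. by rewrite /nsq dotZl dotZr mulrA [c^* * c]mulrC normCK. Qed.

Lemma nsqN A : nsq (- A) = nsq A.
Proof. by rewrite /nsq dotNl dotNr opprK. Qed.

Lemma nsqD A B : nsq (A + B) = nsq A + nsq B + (dot A B + (dot A B)^*).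
Proof. by rewrite /nsq dotDl !dotDr -[(dot A B)^*]dotC; ring. Qed.

Lemma nsqB A B : nsq (A - B) = nsq A + nsq B - (dot A B + (dot A B)^*).
Proof. by rewrite nsqD nsqN dotNr rmorphN opprD. Qed.

Lemma nsqD_orth A B : dot A B = 0 -> nsq (A + B) = nsq A + nsq B.
Proof. by move=> h; rewrite nsqD h conjC0 !addr0. Qed.

Lemma cauchy_schwarz A B : `|dot A B| ^+ 2 <= nsq A * nsq B.
Proof.
have [->|B0] := eqVneq B 0; first by rewrite dot0r nsq0 mulr0 normr0 expr0n.
have hB : 0 < nsq B by rewrite nsq_gt0.
have := nsq_ge0 (nsq B *: A - dot B A *: B).
rewrite nsqB !nsqZ dotZl dotZr nsq_real (dotC B A) norm_conjC.
set c := dot B A; rewrite !rmorphM /= conjCK nsq_real normCK (ger0_norm (nsq_ge0 B)) => h.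
rewrite -subr_ge0 -(pmulr_rge0 _ hB); apply: le_trans h _.
rewrite le_eqVlt; apply/orP; left; apply/eqP; ring.
Qed.

End Dot.

Lemma trmxC_mul m n r (A : 'M[C]_(m, n)) (B : 'M[C]_(n, r)) :
  (A *m B)^t* = B^t* *m A^t*.
Proof. by rewrite trmx_mul map_mxM. Qed.

Lemma trmxC_add m n (A B : 'M[C]_(m, n)) : (A + B)^t* = A^t* + B^t*.
Proof. by rewrite linearD /= map_mxD. Qed.

Lemma trmxC_opp m n (A : 'M[C]_(m, n)) : (- A)^t* = - A^t*.
Proof. by rewrite linearN /= map_mxN. Qed.

Lemma trmxC_scale m n (c : C) (A : 'M[C]_(m, n)) : (c *: A)^t* = c^* *: A^t*.
Proof. by rewrite linearZ /= map_mxZ. Qed.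

Lemma trmxC0 m n : (0 : 'M[C]_(m, n))^t* = 0.
Proof. by rewrite trmx0 map_mx0. Qed.

Lemma trmxC1 m : (1%:M : 'M[C]_m)^t* = 1%:M.
Proof. by rewrite trmx1 map_mx1. Qed.

Lemma trmxC_delta m n (i : 'I_m) (j : 'I_n) :
  (delta_mx i j : 'M[C]_(m, n))^t* = delta_mx j i.
Proof.
by apply/matrixP => a b; rewrite !mxE andbC; case: (_ && _); rewrite ?rmorph0 ?rmorph1.
Qed.

Lemma dot_mull m n r (M : 'M[C]_(m, n)) (A : 'M[C]_(n, r)) B :
  dot (M *m A) B = dot A (M^t* *m B).
Proof. by rewrite /dot trmxC_mul mulmxA. Qed.

Lemma dot_mulr m n r (M : 'M[C]_(m, n)) (A : 'M[C]_(m, r)) B :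
  dot A (M *m B) = dot (M^t* *m A) B.
Proof. by rewrite dot_mull trmxCK. Qed.

Lemma nsq_trmxC m n (A : 'M[C]_(m, n)) : nsq (A^t*) = nsq A.
Proof. by rewrite /nsq /dot trmxCK mxtrace_mulC. Qed.

Lemma dot_trmxC m n (A B : 'M[C]_(m, n)) : dot (A^t*) (B^t*) = dot B A.
Proof. by rewrite /dot trmxCK mxtrace_mulC. Qed.

Lemma mx11_dot m (v w : 'cV[C]_m) : v^t* *m w = (dot v w)%:M.
Proof. by rewrite [LHS]mx11_scalar /dot trace_mx11. Qed.

Lemma mx11_row m (v w : 'rV[C]_m) : v *m w^t* = (dot w v)%:M.
Proof. by rewrite [LHS]mx11_scalar /dot mxtrace_mulC trace_mx11. Qed.

Lemma nsq_delta m n (i : 'I_m) (j : 'I_n) : nsq (delta_mx i j : 'M[C]_(m, n)) = 1.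
Proof.
rewrite /nsq /dot trmxC_delta mul_delta_mx /mxtrace (bigD1 j) //= mxE !eqxx.
by rewrite big1 ?addr0 // => l /negPf lj; rewrite mxE lj.
Qed.

Lemma dot_isometry m n r (U : 'M[C]_(m, n)) (A B : 'M[C]_(n, r)) :
  U^t* *m U = 1%:M -> dot (U *m A) (U *m B) = dot A B.
Proof. by move=> h; rewrite dot_mull mulmxA h mul1mx. Qed.

Lemma nsq_isometry m n r (U : 'M[C]_(m, n)) (A : 'M[C]_(n, r)) :
  U^t* *m U = 1%:M -> nsq (U *m A) = nsq A.
Proof. exact: dot_isometry. Qed.

Lemma nsq_col_row m n (x : 'cV[C]_m) (y : 'rV[C]_n) : nsq (x *m y) = nsq x * nsq y.
Proof.
rewrite /nsq dot_mull mulmxA mx11_dot mul_scalar_mx dotZr //.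
Qed.

(** Bessel's inequality for a pair of orthogonal rows; the shorter one is
    measured with the weight of the longer. *)
Lemma bessel2 m (z w : 'rV[C]_m) (v : 'cV[C]_m) :
  dot z w = 0 -> nsq z <= nsq w ->
  nsq (z *m v) + nsq (w *m v) <= nsq w * nsq v.
Proof.
move=> zw lezw.
have [w0|w0] := eqVneq w 0.
  move: lezw; rewrite w0 nsq0 => h.
  have /eqP : nsq z == 0 by rewrite eq_le h nsq_ge0.
  by move/eqP; rewrite nsq_eq0 => /eqP ->; rewrite !mul0mx nsq0 !mul0r addr0.
have hw : 0 < nsq w by rewrite nsq_gt0.
set a := w *m v; set b := z *m v.
have := nsq_ge0 (nsq w *: v - (w^t* *m a + z^t* *m b)).
rewrite nsqB dotZl nsq_real dotDr.
rewrite (dot_mulr (w^t*)) (dot_mulr (z^t*)) !trmxCK -/a -/b.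
rewrite [nsq (_ + _)]nsqD_orth; last first.
  rewrite dot_mulr trmxCK mulmxA mx11_row.
  by rewrite (dotC z w) zw conjC0 -scalemx1 scale0r mul0mx dot0l.
have Ew x (y : 'rV[C]_m) : nsq (y^t* *m (x : 'M_1)) = nsq y * nsq x.
  by rewrite nsq_col_row nsq_trmxC.
rewrite !Ew nsqZ -/(nsq a) -/(nsq b) rmorphM rmorphD /= !nsq_real.
rewrite (ger0_norm (nsq_ge0 w)) => h.
have {}h : 0 <= nsq w * (nsq w * nsq v - (nsq b + nsq a)).
  apply: le_trans h _; rewrite -subr_ge0.
  have := mulr_ge0 _ (nsq_ge0 b); rewrite -subr_ge0 in lezw.
  move=> /(_ _ lezw). congr (_ <= _); ring.
by rewrite -subr_ge0 -(pmulr_rge0 _ hw).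
Qed.

End Forms.

(** * Vectors at which a matrix attains its norm *)

Lemma le_of_eq (C : numDomainType) (x y : C) : x = y -> x <= y.
Proof. by move=> ->. Qed.

Section Orth.
Variable C : numClosedFieldType.

(** The operator norm of A is attained at y; this form avoids both the
    supremum and normalisation. *)
Definition attains p q (A : 'M[C]_(p, q)) (y : 'cV[C]_q) :=
  y != 0 /\ forall v : 'cV[C]_q, nsq (A *m v) * nsq y <= nsq (A *m y) * nsq v.

(** Lemma [strong_BJ_sorth] below identifies this relation with strong
    Birkhoff-James orthogonality. *)
Definition sorth p q r (A : 'M[C]_(p, q)) (B : 'M[C]_(p, r)) :=
  exists2 y, attains A y & B^t* *m (A *m y) = 0.

Lemma attains_neq0 p q (A : 'M[C]_(p, q)) y : attains A y -> A != 0 -> A *m y != 0.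
Proof.
move=> [y0 h]; apply: contraNneq => Ay0; apply/eqP; apply/matrixP => i j.
have := h (delta_mx j 0); rewrite Ay0 nsq0 mul0r => h0.
have hy : 0 < nsq y by rewrite nsq_gt0.
have /eqP : nsq (A *m (delta_mx j 0 : 'cV_q)) == 0.
  by rewrite eq_le nsq_ge0 andbT -(pmulr_lle0 _ hy).
move/eqP; rewrite nsq_eq0 => /eqP /matrixP /(_ i 0).
by rewrite -colE !mxE.
Qed.

Lemma attains_mull p q r (U : 'M[C]_(r, p)) (A : 'M[C]_(p, q)) y :
  U^t* *m U = 1%:M -> attains A y -> attains (U *m A) y.
Proof.
move=> hU [y0 h]; split=> // v.
by rewrite -!mulmxA !(nsq_isometry _ hU); apply: h.
Qed.

Lemma sorth_mull p q r l (U : 'M[C]_(l, p)) (A : 'M[C]_(p, q)) (B : 'M[C]_(p, r)) :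
  U^t* *m U = 1%:M -> sorth A B -> sorth (U *m A) (U *m B).
Proof.
move=> hU [y hy e]; exists y; first exact: attains_mull.
by rewrite trmxC_mul -!mulmxA (mulmxA _ U) hU mul1mx.
Qed.

(** The two summands form a singular value decomposition in which the first
    one has the larger singular value. *)
Lemma attains2 p q (x1 x2 : 'cV[C]_p) (w z : 'rV[C]_q) :
  dot x1 x2 = 0 -> dot z w = 0 -> w != 0 -> nsq x2 * nsq z <= nsq x1 * nsq w ->
  attains (x1 *m w + x2 *m z) (w^t*).
Proof.
move=> x12 zw w0 le.
have sq (x : 'cV[C]_p) : `|sqrtC (nsq x)| ^+ 2 = nsq x.
  by rewrite ger0_norm ?sqrtC_ge0 ?nsq_ge0 // sqrtCK.
have E v : nsq ((x1 *m w + x2 *m z) *m v) =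
    nsq (sqrtC (nsq x2) *: z *m v) + nsq (sqrtC (nsq x1) *: w *m v).
  rewrite mulmxDl -!mulmxA nsqD_orth; last first.
    rewrite dot_mull mulmxA mx11_dot.
    by rewrite x12 -scalemx1 scale0r mul0mx dot0r.
  by rewrite !nsq_col_row -!scalemxAl !nsqZ !sq addrC.
split; first by rewrite -nsq_eq0 nsq_trmxC nsq_eq0.
have wz : dot w z = 0 by rewrite dotC zw conjC0.
move=> v; rewrite !E -!scalemxAl !nsqZ !sq !mx11_row wz.
rewrite -[0%:M]scalemx1 scale0r nsq0 mulr0 add0r nsq_trmxC.
have := @bessel2 _ _ (sqrtC (nsq x2) *: z) (sqrtC (nsq x1) *: w) v.
rewrite dotZl dotZr zw !mulr0 !nsqZ !sq => /(_ erefl le).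
rewrite -!scalemxAl !nsqZ !sq => h.
rewrite -[(dot w w)%:M]scalemx1 nsqZ (ger0_norm (nsq_ge0 w)).
have -> : nsq (1%:M : 'M[C]_1) = 1.
  by rewrite /nsq /dot trmxC1 mul1mx mxtrace1.
rewrite mulr1 [X in _ <= X](_ : _ = nsq x1 * nsq w * nsq v * nsq w); last by rewrite -/(nsq w); ring.
by rewrite ler_wpM2r ?nsq_ge0.
Qed.

Lemma attains2_val p q (x1 x2 : 'cV[C]_p) (w z : 'rV[C]_q) :
  dot z w = 0 -> (x1 *m w + x2 *m z) *m (w^t*) = nsq w *: x1.
Proof.
move=> zw; rewrite mulmxDl -!mulmxA !mx11_row (dotC z w) zw conjC0.
by rewrite !mul_mx_scalar scale0r addr0.
Qed.

(** The operator 1 - e B B^* is a contraction, and it strictly shortens every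
    vector that is not orthogonal to the range of B. *)
Lemma contraction_defect p q (B : 'M[C]_(p, q)) (x : 'cV[C]_p) (beta e : C) :
  (forall v : 'cV[C]_q, nsq (B *m v) <= beta * nsq v) -> 0 < e -> e * beta <= 1 ->
  nsq (x - e *: (B *m (B^t* *m x))) <= nsq x - e * nsq (B^t* *m x).
Proof.
move=> hB e0 eb; set z := B^t* *m x.
have ec : e^* = e by apply/CrealP; apply: gtr0_real.
rewrite nsqB dotZr dot_mulr -/z -/(nsq z) nsqZ rmorphM /= ec nsq_real.
have h : `|e| ^+ 2 * nsq (B *m z) <= e * nsq z.
  rewrite (ger0_norm (ltW e0)) expr2 -mulrA ler_wpM2l ?(ltW e0) //.
  apply: le_trans (ler_wpM2l (ltW e0) (hB z)) _.
  by rewrite mulrA -[leRHS]mul1r ler_wpM2r ?nsq_ge0.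
rewrite -subr_ge0; rewrite -subr_ge0 in h.
apply: le_trans h _; apply: le_of_eq; ring.
Qed.

(** The orthogonal projection onto the line through x; it is 0 if x = 0, since
    0^-1 = 0. *)
Definition line_proj p (x : 'cV[C]_p) : 'M[C]_p := (nsq x)^-1 *: (x *m x^t*).

Lemma line_proj_id p (x : 'cV[C]_p) : line_proj x *m x = x.
Proof.
rewrite /line_proj -scalemxAl -mulmxA mx11_dot mul_mx_scalar scalerA.
have [->|x0] := eqVneq x 0; first by rewrite scaler0.
by rewrite mulVf ?scale1r // nsq_eq0.
Qed.

Lemma line_proj_adj p (x : 'cV[C]_p) : (line_proj x)^t* = line_proj x.
Proof.
by rewrite /line_proj trmxC_scale trmxC_mul trmxCK fmorphV /= nsq_real.
Qed.

Lemma line_proj_orth p (x v : 'cV[C]_p) : dot x v = 0 -> line_proj x *m v = 0.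
Proof.
move=> xv; rewrite /line_proj -scalemxAl -mulmxA mx11_dot xv.
by rewrite mul_mx_scalar scale0r scaler0.
Qed.

Lemma dot_compl p (x v : 'cV[C]_p) : dot x (v - line_proj x *m v) = 0.
Proof. by rewrite dotBr dot_mulr line_proj_adj line_proj_id subrr. Qed.

Lemma line_proj_mul p q (x : 'cV[C]_p) (A : 'M[C]_(p, q)) :
  line_proj x *m A = (nsq x)^-1 *: (x *m (x^t* *m A)).
Proof. by rewrite /line_proj -scalemxAl mulmxA. Qed.

Lemma dot_ev p (l : 'I_p) (v : 'cV[C]_p) : dot (ev l) v = v l 0.
Proof. by rewrite /dot trmxC_delta -rowE trace_mx11 mxE. Qed.

(** A line contains at most one vector of the standard basis up to scalars. *)
Lemma compl_delta_neq0 p (x : 'cV[C]_p) (s t : 'I_p) : s != t ->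
  exists2 l, l \in [:: s; t] & ev l - line_proj x *m ev l != 0.
Proof.
move=> st.
have [e1|?] := eqVneq (ev s - line_proj x *m ev s) 0; last first.
  by exists s => //; rewrite inE eqxx.
have [e2|?] := eqVneq (ev t - line_proj x *m ev t) 0; last first.
  by exists t => //; rewrite !inE eqxx orbT.
have P (l : 'I_p) : ev l - line_proj x *m ev l = 0 ->
    exists c, ev l = c *: x.
  move/eqP; rewrite subr_eq0 line_proj_mul => /eqP ->.
  rewrite [X in x *m X]mx11_scalar mul_mx_scalar scalerA; by eexists.
have [c1 /matrixP h1] := P _ e1; have [c2 /matrixP h2] := P _ e2.
have := h1 s 0; have := h1 t 0; have := h2 t 0.
rewrite !mxE !eqxx /= eq_sym (negPf st) /= => a1 /esym/eqP.
rewrite mulf_eq0 => /orP[] /eqP h; rewrite h ?mul0r ?mulr0 in a1 *.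
  by move/eqP; rewrite oner_eq0.
by move/eqP: a1; rewrite oner_eq0.
Qed.

End Orth.

(** * Block-diagonal matrices *)

Section Blocks.
Variables (C : numClosedFieldType) (N : nat) (T : eqType) (blk : 'I_N -> T).
Local Notation M := 'M[C]_N.

(** The direct sum of matrix algebras, inside one full matrix algebra: the
    blocks are the fibres of blk. *)
Definition blockdiag (A : M) := forall s t, blk s != blk t -> A s t = 0.
Definition supported (j : T) (v : 'cV[C]_N) := forall s, blk s != j -> v s 0 = 0.

Lemma blockdiagD A B : blockdiag A -> blockdiag B -> blockdiag (A + B).
Proof. by move=> hA hB s t st; rewrite mxE hA ?hB ?addr0. Qed.

Lemma blockdiagN A : blockdiag A -> blockdiag (- A).
Proof. by move=> hA s t st; rewrite mxE hA ?oppr0. Qed.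

Lemma blockdiagB A B : blockdiag A -> blockdiag B -> blockdiag (A - B).
Proof. by move=> hA hB; apply: blockdiagD => //; apply: blockdiagN. Qed.

Lemma blockdiagZ c A : blockdiag A -> blockdiag (c *: A).
Proof. by move=> hA s t st; rewrite mxE hA ?mulr0. Qed.

Lemma blockdiag0 : blockdiag 0.
Proof. by move=> s t _; rewrite mxE. Qed.

Lemma blockdiag_diag d : blockdiag (diag_mx d).
Proof.
move=> s t st; rewrite mxE; have [e|] := eqVneq s t; last by [].
by rewrite e eqxx in st.
Qed.

Lemma blockdiag1 : blockdiag 1%:M.
Proof. by rewrite -diag_const_mx; apply: blockdiag_diag. Qed.

Lemma blockdiag_delta s t : blk s = blk t -> blockdiag (delta_mx s t).
Proof.
move=> st a b; rewrite mxE; have [->|//] := eqVneq a s.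
by have [->|//] := eqVneq b t; rewrite st eqxx.
Qed.

Lemma blockdiagM A B : blockdiag A -> blockdiag B -> blockdiag (A *m B).
Proof.
move=> hA hB s t st; rewrite mxE big1 // => l _.
have [e|ne] := eqVneq (blk s) (blk l); last by rewrite hA ?mul0r.
by rewrite hB ?mulr0 // -e.
Qed.

Lemma blockdiag_adj A : blockdiag A -> blockdiag (A^t*).
Proof. by move=> hA s t st; rewrite !mxE hA ?rmorph0 // eq_sym. Qed.

Lemma supported_delta s : supported (blk s) (ev s).
Proof. by move=> t ts; rewrite mxE; have [e|//] := eqVneq t s; rewrite e eqxx in ts. Qed.

Lemma supportedZ j c v : supported j v -> supported j (c *: v).
Proof. by move=> hv s hs; rewrite mxE hv ?mulr0. Qed.

Lemma supportedB j v w : supported j v -> supported j w -> supported j (v - w).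
Proof. by move=> hv hw s hs; rewrite !mxE hv ?hw ?subr0. Qed.

Lemma supportedM j A v : blockdiag A -> supported j v -> supported j (A *m v).
Proof.
move=> hA hv s hs; rewrite mxE big1 // => l _.
have [e|ne] := eqVneq (blk s) (blk l); last by rewrite hA ?mul0r.
by rewrite hv ?mulr0 // -e.
Qed.

Lemma blockdiag_outer j v w : supported j v -> supported j w ->
  blockdiag (v *m w^t*).
Proof.
move=> hv hw s t st; rewrite mxE big_ord1 !mxE.
have [e|ne] := eqVneq (blk s) j; last by rewrite hv ?mul0r.
by rewrite hw ?rmorph0 ?mulr0 // -e eq_sym.
Qed.

Lemma blockdiag_line_proj j v : supported j v -> blockdiag (line_proj v).
Proof. by move=> hv; apply/blockdiagZ/blockdiag_outer; apply: hv. Qed.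

(** If l is outside the block j of x, the projection kills the basis vector;
    otherwise all vectors involved lie in the block j. *)
Lemma supported_compl j x l : supported j x ->
  supported (blk l) (ev l - line_proj x *m ev l).
Proof.
move=> hx; have [e|ne] := eqVneq (blk l) j.
  rewrite e; apply: supportedB; last apply: supportedM.
  - by rewrite -e; apply: supported_delta.
  - exact: blockdiag_line_proj hx.
  - by rewrite -e; apply: supported_delta.
rewrite line_proj_orth ?subr0; first exact: supported_delta.
rewrite /dot -colE trace_mx11 !mxE.
by rewrite hx ?rmorph0.
Qed.

Lemma dot_supported j (v w : 'cV[C]_N) : supported j v ->
  (forall s, blk s = j -> w s 0 = 0) -> dot v w = 0.
Proof.
move=> hv hw; rewrite dotE big_ord1 big1 // => s _.
have [e|ne] := eqVneq (blk s) j; first by rewrite hw ?mulr0.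
by rewrite hv ?rmorph0 ?mul0r.
Qed.

(** Both sides of the attainment inequality add up over the block components
    of y, so equality for y forces equality for each component. *)
Lemma attains_supported A y : blockdiag A -> attains A y ->
  exists j, exists2 y', supported j y' & attains A y'.
Proof.
move=> hA [y0 hy].
have [s ys] : exists s, y s 0 != 0.
  apply/existsP; apply: contraNT y0; rewrite negb_exists => /forallP h.
  apply/eqP; apply/matrixP => s t; rewrite ord1 mxE; apply/eqP.
  by have := h s; rewrite negbK.
set y1 : 'cV[C]_N := \col_t (if blk t == blk s then y t 0 else 0).
have s1 : supported (blk s) y1 by move=> t ts; rewrite mxE (negPf ts).
have y10 : y1 != 0.
  by apply: contraNneq ys => /matrixP /(_ s 0); rewrite !mxE eqxx => ->.
exists (blk s), y1 => //; split=> // v.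
pose y2 := y - y1.
have ey : y = y1 + y2 by rewrite addrC subrK.
have y2s t : blk t = blk s -> y2 t 0 = 0 by move=> ts; rewrite !mxE ts eqxx subrr.
have Ay2s t : blk t = blk s -> (A *m y2) t 0 = 0.
  move=> ts; rewrite mxE big1 // => l _.
  have [e|ne] := eqVneq (blk l) (blk t); first by rewrite y2s ?mulr0 // e.
  by rewrite hA ?mul0r // eq_sym.
have n1 : nsq y = nsq y1 + nsq y2.
  by rewrite [in LHS]ey nsqD_orth //; apply: dot_supported s1 y2s.
have n2 : nsq (A *m y) = nsq (A *m y1) + nsq (A *m y2).
  rewrite [in LHS]ey mulmxDr nsqD_orth //.
  by apply: dot_supported Ay2s; apply: supportedM.
have hy0 : 0 < nsq y by rewrite nsq_gt0.
have h2 := hy y2.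
have h1 : nsq (A *m y) * nsq y1 <= nsq (A *m y1) * nsq y.
  move: h2; rewrite -subr_ge0 => h2; rewrite -subr_ge0; apply: le_trans h2 _.
  apply: le_of_eq.
  by rewrite [in X in X = _]n2 [in X in _ = X]n2 n1; ring.
rewrite -(ler_pM2r hy0).
have := ler_wpM2r (nsq_ge0 y1) (hy v); have := ler_wpM2r (nsq_ge0 v) h1.
move=> b1 b2; apply: le_trans (_ : nsq (A *m y) * nsq y1 * nsq v <= _).
  apply: le_trans (_ : nsq (A *m y) * nsq v * nsq y1 <= _).
    apply: le_trans b2; apply: le_of_eq; ring.
  apply: le_of_eq; ring.
apply: le_trans b1 _; apply: le_of_eq; ring.
Qed.

End Blocks.

(** * Existence of norm-attaining vectors *)

Section Exists.
Variable C : numClosedFieldType.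

(** The norm of A is attained at an eigenvector for the largest eigenvalue of
    A^* A. *)
Lemma attains_exists p q (A : 'M[C]_(p, q)) : (0 < q)%N -> exists y, attains A y.
Proof.
move=> q0; pose H := A^t* *m A.
have nH : H \is normalmx.
  by apply/normalmxP; rewrite /H trmxC_mul trmxCK.
have /orthomx_spectralP := nH.
set P := spectralmx H; set d := spectral_diag H.
have uP : P \is unitarymx by apply: spectral_unitarymx.
rewrite (invmx_unitary uP) => eH.
have PP : P *m P^t* = 1%:M by apply/unitarymxP.
have P'P : P^t* *m P = 1%:M by apply/mulmx1C.
have nA (v : 'cV[C]_q) : nsq (A *m v) = dot (P *m v) (diag_mx d *m (P *m v)).
  by rewrite /nsq dot_mull mulmxA -/H eH -!mulmxA dot_mulr trmxCK.
have dE (w : 'cV[C]_q) : dot w (diag_mx d *m w) = \sum_i d 0 i * `|w i 0| ^+ 2.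
  rewrite dotE big_ord1; apply: eq_bigr => i _.
  by rewrite mul_diag_mx mxE normCK; ring.
have dev i : nsq (A *m (P^t* *m ev i)) = d 0 i.
  rewrite nA mulmxA PP mul1mx dE (bigD1 i) //= mxE !eqxx normr1 expr1n mulr1.
  by rewrite big1 ?addr0 // => l /negPf li; rewrite mxE li normr0 expr0n mulr0.
have d0 i : 0 <= d 0 i by rewrite -dev nsq_ge0.
have [i hi] : exists i, forall l, d 0 l <= d 0 i.
  have dr : {in xpredT, forall l, d 0 l \is Num.real}.
    by move=> l _; apply: ger0_real.
  have [i _ hi] := @real_arg_maxP _ _ (Ordinal q0) xpredT (d 0) erefl dr.
  by exists i => l; apply: hi.
have n1 : nsq (P^t* *m ev i) = 1.
  by rewrite nsq_isometry ?nsq_delta // trmxCK.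
exists (P^t* *m ev i); split=> [|v].
  by rewrite -nsq_eq0 n1 oner_eq0.
rewrite n1 dev mulr1 nA dE -(nsq_isometry v P'P) nsqE big_ord1 mulr_sumr.
by apply: ler_sum => l _; rewrite ler_wpM2r ?exprn_ge0 //; apply: hi.
Qed.

Lemma orthogonal_ranges_sorth p q r (A : 'M[C]_(p, q)) (B : 'M[C]_(p, r)) :
  (0 < q)%N -> B^t* *m A = 0 -> sorth A B.
Proof.
move=> q0 BA; have [y hy] := attains_exists A q0.
by exists y => //; rewrite mulmxA BA mul0mx.
Qed.

End Exists.

(** * Preimages of unitaries have no zero row *)

Section Singular.
Variables (C : numClosedFieldType) (N : nat) (T : eqType) (blk : 'I_N -> T).
Hypothesis N_ge3 : (2 < N)%N.
Local Notation D := (@blockdiag C N T blk).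
Local Notation supp := (@supported C N T blk).
Variable Phi : 'M[C]_N -> 'M[C]_N.
Hypothesis Phi_add : {morph Phi : a b / a + b}.
Hypothesis Phi_surj : forall b, D b -> exists2 a, D a & Phi a = b.
Hypothesis Phi_pres : forall a b, D a -> D b -> sorth a b -> sorth b a ->
  sorth (Phi a) (Phi b).

Let Phi0 := additive_map0 Phi_add.
Let PhiB := additive_mapB Phi_add.
Let Phi_sum := additive_map_sum Phi_add.

(** The vector at which a attains its norm is mapped by a to a vector that u^*
    kills, hence to 0. *)
Lemma sorth_unitary (a u : 'M[C]_N) : u *m u^t* = 1%:M -> sorth a u -> a = 0.
Proof.
move=> uu [y hy e]; apply/eqP; apply: contraTT isT => a0.
have /negP := attains_neq0 hy a0; apply: contra_notT => _; apply/eqP.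
by rewrite -[_ *m y]mul1mx -uu -mulmxA e mulmx0.
Qed.

Section OneSingular.
Variables (b u : 'M[C]_N) (m : 'I_N) (j : T) (y : 'cV[C]_N).
Hypothesis Db : D b.
Hypothesis Phib : Phi b = u.
Hypothesis uu : u *m u^t* = 1%:M.
Hypothesis rowb : row m b = 0.
Hypothesis yj : supp j y.
Hypothesis yb : attains b y.
Let x : 'cV[C]_N := b *m y.

Let xm : x m 0 = 0.
Proof.
have /rowP h := congr1 (mulmx^~ y) rowb.
by have := h 0; rewrite /= -row_mul mul0mx !mxE.
Qed.

Let xj : supp j x. Proof. exact: supportedM. Qed.

(** As row m of b vanishes, the m-th basis vector is orthogonal to the range
    of b, and the matrix below attains its norm in that direction; its own
    range is orthogonal to x = b y, where b attains its norm. So the two are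
    mutually orthogonal, and [sorth_unitary] applies to their images. *)
Lemma killed_pair l (z : 'cV[C]_N) (r1 r2 : 'rV[C]_N) :
  supp (blk m) (r1^t*) -> supp l (r2^t*) -> supp l z -> z m 0 = 0 ->
  dot z x = 0 -> dot r2 r1 = 0 -> r1 != 0 -> nsq z * nsq r2 <= nsq r1 ->
  Phi (ev m *m r1 + z *m r2) = 0.
Proof.
move=> s1 s2 sz zm zx r12 r10 le.
have Dc : D (ev m *m r1 + z *m r2).
  apply: blockdiagD.
    by rewrite -[r1]trmxCK; apply: blockdiag_outer s1; apply: supported_delta.
  by rewrite -[r2]trmxCK; apply: blockdiag_outer s2.
apply: (sorth_unitary uu); rewrite -Phib; apply: Phi_pres => //.
  exists (r1^t*); first by apply: attains2; rewrite ?dot_ev // nsq_delta mul1r.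
  rewrite attains2_val // -scalemxAr.
  have -> : b^t* *m ev m = 0; last by rewrite scaler0.
  apply/matrixP => s t; rewrite -colE !mxE.
  by have /rowP/(_ s) := rowb; rewrite !mxE => ->; rewrite rmorph0.
exists y => //; rewrite -/x trmxC_add mulmxDl !trmxC_mul -!mulmxA !mx11_dot.
by rewrite dot_ev xm zx !mul_mx_scalar !scale0r addr0.
Qed.

Lemma killed_row (r : 'rV[C]_N) : supp (blk m) (r^t*) -> Phi (ev m *m r) = 0.
Proof.
move=> sr; have [->|r0] := eqVneq r 0; first by rewrite mulmx0.
have := @killed_pair (blk m) 0 r 0; rewrite mulmx0 addr0; apply => //.
- by rewrite trmxC0 => s _; rewrite mxE.
- by move=> s _; rewrite mxE.
- by rewrite mxE.
- exact: dot0l.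
- exact: dot0l.
- by rewrite nsq0 mul0r nsq_ge0.
Qed.

Lemma killed_elem l (z : 'cV[C]_N) s c :
  supp l z -> z m 0 = 0 -> dot z x = 0 -> blk s = l ->
  Phi (z *m (c *: delta_mx 0 s)) = 0.
Proof.
move=> sz zm zx sl.
have [->|z0] := eqVneq z 0; first by rewrite mul0mx.
(* The row placed at m must be orthogonal to the s-th one: take another
   basis row of the block of m. If s = m, the column z has a nonzero entry
   elsewhere in that block. *)
have [s' s'm s's] : exists2 s', blk s' = blk m & s' != s.
  have [e|ne] := eqVneq s m; last by exists m => //; rewrite eq_sym.
  have [t tz] : exists t, z t 0 != 0.
    apply/existsP; apply: contraNT z0; rewrite negb_exists => /forallP h.
    apply/eqP/matrixP => a t; rewrite ord1 mxE; apply/eqP.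
    by have := h a; rewrite negbK.
  exists t; last by rewrite e; apply: contraNneq tz => ->; rewrite zm.
  rewrite -e sl; apply/eqP; apply: contraNT tz => tl; by rewrite sz.
(* K^2 dominates nsq z * |c|^2, so the row at m carries the norm. *)
pose K := 1 + nsq z * `|c| ^+ 2.
have q0 : 0 <= nsq z * `|c| ^+ 2 by rewrite mulr_ge0 ?nsq_ge0 ?exprn_ge0.
have K0 : 0 < K by rewrite ltr_wpDr.
have s1 : supp (blk m) ((K *: delta_mx 0 s' : 'rV[C]_N)^t*).
  rewrite trmxC_scale trmxC_delta -s'm.
  by apply: supportedZ; apply: supported_delta.
have := @killed_pair l z (K *: delta_mx 0 s') (c *: delta_mx 0 s) s1.
rewrite Phi_add killed_row // add0r; apply => //.
- rewrite trmxC_scale trmxC_delta -sl.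
  by apply: supportedZ; apply: supported_delta.
- rewrite dotZl dotZr /dot trmxC_delta mul_delta_mx /mxtrace big1 ?mulr0 //.
  move=> t _; rewrite mxE; case: eqVneq => // ->.
  by rewrite eq_sym (negPf s's).
- rewrite -nsq_eq0 nsqZ nsq_delta mulr1 expf_eq0 normr_eq0.
  by rewrite gt_eqF.
- rewrite !nsqZ !nsq_delta !mulr1 (ger0_norm (ltW K0)) expr2.
  apply: le_trans (_ : K <= _); first by rewrite /K lerDr.
  by rewrite ler_peMr ?(ltW K0) // /K lerDl.
Qed.

(** The kernel of Phi contains z w for all columns z orthogonal to x: for the
    m-th basis vector and for those z with zero m-th entry by the previous
    lemmas. These columns span the complement of x. *)
Lemma factor_line a : D a -> Phi a = Phi (line_proj x *m a).
Proof.
move=> Da; apply/eqP; rewrite -subr_eq0 -PhiB.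
have -> : a - line_proj x *m a =
  \sum_t \sum_s (ev t - line_proj x *m ev t) *m (a t s *: delta_mx 0 s).
  under eq_bigr => t _.
    under eq_bigr => s _ do
      rewrite -scalemxAr mulmxBl -mulmxA mul_delta_mx scalerBr scalemxAr.
    rewrite sumrB -mulmx_sumr; over.
  by rewrite sumrB -mulmx_sumr -matrix_sum_delta.
rewrite Phi_sum big1 // => t _; rewrite Phi_sum big1 // => s _.
have [ts|ts] := eqVneq (blk s) (blk t); last first.
  by rewrite Da 1?eq_sym // scale0r mulmx0 Phi0.
have [e|tm] := eqVneq t m.
  rewrite e line_proj_orth ?subr0; last first.
    by rewrite dotC dot_ev xm rmorph0.
  apply: killed_row; rewrite trmxC_scale trmxC_delta -e -ts.
  by apply: supportedZ; apply: supported_delta.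
apply: killed_elem ts.
- exact: supported_compl xj.
- rewrite 2!mxE eq_sym (negPf tm) /= mxE line_proj_mul.
  rewrite [X in x *m X]mx11_scalar mul_mx_scalar 3!mxE xm.
  by rewrite !mulr0 subr0.
- by rewrite dotC dot_compl rmorph0.
Qed.

End OneSingular.

(** Otherwise [factor_line] shows that Phi only sees a through a projection
    onto a line. Changing b off this line, which does not affect Phi b, one
    can make it attain its norm at a direction z orthogonal to x; this
    requires a third dimension. Then Phi only sees the projection onto z as
    well, so Phi = 0. *)
Lemma preimage_row_neq0 (b u : 'M[C]_N) m :
  D b -> Phi b = u -> u *m u^t* = 1%:M -> row m b != 0.
Proof.
move=> Db Phib uu; apply/eqP => rowb.
have N0 : (0 < N)%N by apply: ltn_trans N_ge3.
have u0 : u != 0.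
  apply/eqP => u0; have /matrixP/(_ (Ordinal N0) (Ordinal N0)) := uu.
  by rewrite u0 mul0mx !mxE eqxx => /eqP; rewrite eq_sym oner_eq0.
have b0 : b != 0 by apply: contraNneq u0 => b0; rewrite -Phib b0 Phi0.
have [y0 yb0] := attains_exists b N0.
have [j [y yj yb]] := attains_supported Db yb0.
pose x : 'cV[C]_N := b *m y; pose r := x^t* *m b.
have x0 : x != 0 by apply: attains_neq0.
have xj : supp j x by apply: supportedM.
have fx := factor_line Db Phib uu rowb yj yb.
have xm : x m 0 = 0.
  have /rowP h := congr1 (mulmx^~ y) rowb.
  by have := h 0; rewrite /= -row_mul mul0mx !mxE.
rewrite -/x in fx; clearbody x.
(* Of two basis vectors other than the m-th, one is not on the line of x;
   its component z orthogonal to x is the new direction. *)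
have [l1 [l2 [l12 l1m l2m]]] : exists l1 l2 : 'I_N, [/\ l1 != l2, l1 != m & l2 != m].
  have : (1 < #|predC1 m|)%N by rewrite cardC1 card_ord; case: N N_ge3 => [|[|[]]].
  by case/card_gt1P => l1 [l2] [h1 h2 h12]; exists l1, l2.
have [l ll z0] := compl_delta_neq0 x l12.
have {l1 l2 l12 l1m l2m ll} lm : l != m.
  by move: ll; rewrite !inE => /orP[] /eqP ->.
pose z := ev l - line_proj x *m ev l.
have zl : supp (blk l) z by apply: supported_compl xj.
have xz : dot x z = 0 by apply: dot_compl.
have zx : dot z x = 0 by rewrite dotC xz rmorph0.
have zm : z m 0 = 0.
  have Pm : (line_proj x *m ev l) m 0 = 0.
    rewrite line_proj_mul [X in x *m X]mx11_scalar mul_mx_scalar 2!mxE xm.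
    by rewrite !mulr0.
  by rewrite /z 3!mxE Pm eq_sym (negPf lm) /= subr0.
have rj : supp j (r^t*).
  by rewrite trmxC_mul trmxCK; apply: supportedM => //; apply: blockdiag_adj.
(* r is the row of b along x; a row orthogonal to it is placed along z, so
   that the two terms of b' form a singular value decomposition. *)
have [w wl [w0 rw]] : exists2 w, supp (blk l) (w : 'cV[C]_N) & w != 0 /\ dot (r^t*) w = 0.
  have [lj|lj] := eqVneq (blk l) j; last first.
    exists (ev l); first exact: supported_delta.
    by rewrite -nsq_eq0 nsq_delta oner_eq0 dotC dot_ev rj ?rmorph0.
  have [t tl xt] : exists2 t, t != l & x t 0 != 0.
    have [/existsP[t /andP[]]|/existsPn h] := boolP [exists t, (t != l) && (x t 0 != 0)].
      by exists t.
    case/eqP: z0; rewrite -/z.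
    have xe : x = x l 0 *: ev l.
      apply/matrixP => t i; rewrite ord1 !mxE.
      have [->|tl] := eqVneq t l; first by rewrite mulr1.
      by have := h t; rewrite tl /= negbK => /eqP ->; rewrite mulr0.
    have xl0 : x l 0 != 0 by apply: contraNneq x0 => e; rewrite xe e scale0r.
    have e : ev l = (x l 0)^-1 *: x by rewrite {2}xe scalerA mulVf ?scale1r.
    by rewrite /z e -scalemxAr line_proj_id subrr.
  have tj : blk t = j by apply/eqP; apply: contraNT xt => tj; rewrite xj.
  have [k kk k0] := compl_delta_neq0 (r^t*) tl.
  exists (ev k - line_proj (r^t*) *m ev k); last by split=> //; apply: dot_compl.
  have -> : blk l = blk k by move: kk; rewrite !inE => /orP[] /eqP -> //; rewrite tj.
  exact: supported_compl rj.
(* K makes z the dominant left singular vector of b'. *)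
pose K := 1 + nsq x * nsq ((nsq x)^-1 *: r) / (nsq z * nsq w).
have hz : 0 < nsq z by rewrite nsq_gt0.
have hw : 0 < nsq w by rewrite nsq_gt0.
have zw0 : 0 < nsq z * nsq w by rewrite mulr_gt0.
have q0 : 0 <= nsq x * nsq ((nsq x)^-1 *: r) / (nsq z * nsq w).
  by rewrite divr_ge0 ?mulr_ge0 ?nsq_ge0.
have K0 : 0 < K by rewrite ltr_wpDr.
pose w' : 'rV[C]_N := K *: w^t*.
pose b' := z *m w' + x *m ((nsq x)^-1 *: r).
have eb' : b' = z *m w' + line_proj x *m b by rewrite line_proj_mul scalemxAr.
have Dzw : D (z *m w').
  by rewrite -scalemxAr; apply: blockdiagZ; apply: blockdiag_outer zl wl.
have Db' : D b'.
  by rewrite eb'; apply: blockdiagD => //; apply: blockdiagM => //;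
     apply: blockdiag_line_proj xj.
have Phib' : Phi b' = u.
  rewrite eb' Phi_add -fx // Phib (fx (z *m w')) // mulmxA.
  by rewrite line_proj_orth // mul0mx Phi0 add0r.
have rowb' : row m b' = 0.
  rewrite /b' linearD /= !row_mul.
  have r0 (v : 'cV[C]_N) : v m 0 = 0 -> row m v = 0.
    by move=> vm; apply/rowP => i; rewrite ord1 !mxE.
  by rewrite !r0 // !mul0mx addr0.
have dw : dot ((nsq x)^-1 *: r) w' = 0.
  by rewrite dotZl dotZr -[r]trmxCK dot_trmxC dotC rw rmorph0 !mulr0.
have w'0 : w' != 0.
  by rewrite -nsq_eq0 nsqZ nsq_trmxC mulf_eq0 expf_eq0 normr_eq0 (gt_eqF K0) gt_eqF.
have att : attains b' (w'^t*).
  apply: attains2 => //.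
  rewrite [nsq w']nsqZ nsq_trmxC (ger0_norm (ltW K0)).
  rewrite mulrCA -ler_pdivrMr // expr2.
  apply: le_trans (_ : K <= _); first by rewrite /K lerDr.
  by rewrite ler_peMr ?(ltW K0) // /K lerDl.
have w'l : supp (blk l) (w'^t*) by rewrite trmxC_scale trmxCK; apply: supportedZ.
have fz := factor_line Db' Phib' uu rowb' w'l att.
have b'w' : b' *m w'^t* = nsq w' *: z by apply: attains2_val.
have [a Da Pa] := Phi_surj (@blockdiag1 C N T blk).
have Dz : D (line_proj (b' *m w'^t*)).
  by apply: (@blockdiag_line_proj _ _ _ _ (blk l)); apply: supportedM.
have : Phi a = 0.
  rewrite fz // fx; last exact: blockdiagM.
  rewrite mulmxA line_proj_mul.
  have -> : x^t* *m line_proj (b' *m w'^t*) = 0; last by rewrite mulmx0 scaler0 mul0mx Phi0.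
  rewrite -[LHS]trmxCK trmxC_mul line_proj_adj trmxCK line_proj_orth ?trmxC0 //.
  by rewrite b'w' dotZl zx mulr0.
rewrite Pa => /matrixP/(_ (Ordinal N0) (Ordinal N0)); rewrite !mxE eqxx.
by move/eqP; rewrite oner_eq0.
Qed.

End Singular.

(** * Sums of unimodular numbers *)

Section Unimodular.
Variable C : numClosedFieldType.

(** The two diagonals of a rhombus are orthogonal: complete z / 2 by an
    orthogonal vector to a vector of modulus 1. *)
Lemma unimodular_sum (z : C) : `|z| <= 2 ->
  exists w1 w2, [/\ `|w1| = 1, `|w2| = 1 & z = w1 + w2].
Proof.
move=> z2; have [->|z0] := eqVneq z 0.
  by exists 1, (-1); rewrite normrN normr1 subrr.
pose w := z / 2; have w0 : w != 0 by rewrite mulf_neq0 ?invr_eq0 ?pnatr_eq0.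
have nw0 : 0 < `|w| by rewrite normr_gt0.
have nw1 : `|w| <= 1 by rewrite normrM normfV normr_nat ler_pdivrMr ?mul1r.
have h0 : 0 <= `|w| ^- 2 - 1 by rewrite subr_ge0 invf_ge1 ?exprn_gt0 ?exprn_ile1.
pose h := sqrtC (`|w| ^- 2 - 1).
have h1 : 0 <= h by rewrite sqrtC_ge0.
have hc : h^* = h by apply/CrealP; apply: ger0_real.
have unit (c : C) : c * c^* = h ^+ 2 -> c^* = - c -> `|w * (1 + c)| = 1.
  move=> cc cN; apply: (@pexpIrn _ 2) => //; rewrite ?nnegrE //.
  rewrite normrM exprMn (normCK (1 + c)) rmorphD /= rmorph1.
  have -> : (1 + c) * (1 + c^*) = 1 + c * c^* by rewrite cN; ring.
  rewrite cc sqrtCK addrC subrK mulfV ?expr1n //.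
  by rewrite expf_eq0 gt_eqF.
have ii : 'i * 'i = -1 :> C by rewrite -expr2 sqrCi.
have c1 : ('i * h)^* = - ('i * h) by rewrite rmorphM /= hc conjCi mulNr.
exists (w * (1 + 'i * h)), (w * (1 - 'i * h)); split.
- apply: unit => //; rewrite c1 mulrN mulrACA ii; ring.
- by apply: unit; rewrite rmorphN /= c1 ?opprK // mulNr mulrACA ii; ring.
- by rewrite -mulrDr /w; field.
Qed.

Hypothesis archi : forall x : C, 0 <= x -> exists k : nat, x <= k%:R.

Lemma unimodular_multiple (z : C) :
  exists (k : nat) w1 w2, [/\ `|w1| = 1, `|w2| = 1 & z = (w1 + w2) *+ k].
Proof.
have [k hk] := archi (normr_ge0 z).
have [w1 [w2 [h1 h2 e]]] : exists w1 w2, [/\ `|w1| = 1, `|w2| = 1 & z / k.+1%:R = w1 + w2].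
  apply: unimodular_sum; rewrite normrM normfV normr_nat ler_pdivrMr ?ltr0n //.
  by apply: le_trans hk _; rewrite -natrM ler_nat (leq_trans (leqnSn k)) ?leq_pmull.
by exists k.+1, w1, w2; split=> //; rewrite -e -[RHS]mulr_natr divfK ?pnatr_eq0.
Qed.

End Unimodular.

(** * Contractions resolving the identity *)

Section Contraction.
Variable C : numClosedFieldType.

(** If p attains its norm at y and q^* p y = 0, then x = p y satisfies p^* x =
    u^* x, so that |x|^2 = <y, u^* x> <= |y| |x|. *)
Lemma sorth_contraction N (p q u : 'M[C]_N) :
  u *m u^t* = 1%:M -> p + q = u -> sorth p q ->
  (forall v : 'cV[C]_N, nsq (p *m v) <= nsq v) /\
  exists2 x : 'cV[C]_N, p^t* *m x = u^t* *m x & p != 0 -> x != 0.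
Proof.
move=> uu pq [y hy e]; have [y0 att] := hy; pose x := p *m y.
have hx : p^t* *m x = u^t* *m x by rewrite -pq trmxC_add mulmxDl e addr0.
have hy0 : 0 < nsq y by rewrite nsq_gt0.
split; last by exists x => //; apply: attains_neq0.
have le : nsq x <= nsq y.
  have [->|x0] := eqVneq x 0; first by rewrite nsq0 nsq_ge0.
  have hx0 : 0 < nsq x by rewrite nsq_gt0.
  have : nsq x = dot y (u^t* *m x) by rewrite -hx -dot_mull.
  have := cauchy_schwarz y (u^t* *m x) => cs ex.
  move: cs; rewrite -ex nsq_isometry ?trmxCK // (ger0_norm (nsq_ge0 x)) expr2.
  by rewrite ler_pM2r.
move=> v; rewrite -(ler_pM2r hy0); apply: le_trans (att v) _.
by rewrite mulrC ler_wpM2l ?nsq_ge0.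
Qed.

Lemma contraction_fix N (r : 'M[C]_N) (x : 'cV[C]_N) :
  (forall v : 'cV[C]_N, nsq (r *m v) <= nsq v) -> r^t* *m x = x -> r *m x = x.
Proof.
move=> hr hx; apply/eqP; rewrite -subr_eq0 -nsq_eq0 eq_le nsq_ge0 andbT.
rewrite nsqB dot_mull hx -/(nsq x) nsq_real.
have -> : nsq (r *m x) + nsq x - (nsq x + nsq x) = nsq (r *m x) - nsq x by ring.
by rewrite subr_le0.
Qed.

(** If r_m x_m = x_m, the identity sum r = 1 leaves nothing for the other r_l
    x_m: their real parts along x_m are nonnegative, because 1 - r_l is a
    contraction, and add up to 0. Hence r_l x_m = 0, the x_m are orthogonal,
    and there are enough of them to form a basis. *)
Lemma resolution_of_identity N (r : 'I_N -> 'M[C]_N) :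
  \sum_m r m = 1%:M ->
  (forall m v, nsq (r m *m (v : 'cV[C]_N)) <= nsq v) ->
  (forall m v, nsq ((1%:M - r m) *m (v : 'cV[C]_N)) <= nsq v) ->
  (forall m, exists2 x : 'cV[C]_N, (r m)^t* *m x = x & x != 0) ->
  exists2 X : 'M[C]_N, X^t* *m X = 1%:M & forall m, r m = X *m delta_mx m m *m X^t*.
Proof.
move=> sum1 contr ccontr.
move=> /(@fin_all_exists2 _ _ (fun m x => (r m)^t* *m x = x)) [x hx x0].
have rx m : r m *m x m = x m by apply: contraction_fix.
have rlx m l : l != m -> r l *m x m = 0.
  have pos i : nsq (r i *m x m) <= dot (x m) (r i *m x m) + (dot (x m) (r i *m x m))^*.
    have := ccontr i (x m); rewrite mulmxBl mul1mx nsqB.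
    by rewrite -subr_ge0 => h; rewrite -subr_ge0; apply: le_trans h _; apply: le_of_eq; ring.
  have s0 : \sum_(i | i != m) r i *m x m = 0.
    rewrite -mulmx_suml; apply: (addrI (r m *m x m)).
    by have := sum1; rewrite (bigD1 m) //= addr0 -mulmxDl => ->; rewrite mul1mx rx.
  have : \sum_(i | i != m) nsq (r i *m x m) <= 0.
    apply: le_trans (ler_sum _ (fun i _ => pos i)) _.
    by rewrite big_split /= -rmorph_sum -dot_sumr s0 dot0r rmorph0 addr0.
  move=> le lm; apply/eqP; rewrite -nsq_eq0 eq_le nsq_ge0 andbT.
  apply: le_trans le; rewrite (bigD1 l) //= lerDl.
  by apply: sumr_ge0 => i _; apply: nsq_ge0.
have orth m l : l != m -> dot (x l) (x m) = 0.
  by move=> lm; rewrite -(hx l) -dot_mulr rlx // dot0r.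
pose c m := (sqrtC (nsq (x m)))^-1.
pose X := \matrix_(s, m) (c m * x m s 0).
have cX m : X *m ev m = c m *: x m.
  by apply/matrixP => s i; rewrite -colE !mxE ord1.
have cc m : (c m)^* * c m * nsq (x m) = 1.
  rewrite fmorphV /=; have -> : (sqrtC (nsq (x m)))^* = sqrtC (nsq (x m)).
    by apply/CrealP; rewrite ger0_real // sqrtC_ge0 nsq_ge0.
  by rewrite -invfM -expr2 sqrtCK mulVf // nsq_eq0.
have XX : X^t* *m X = 1%:M.
  apply/matrixP => l m.
  have -> : (X^t* *m X) l m = dot (X *m ev l) (X *m ev m).
    by rewrite dot_mull dot_ev mulmxA -colE [RHS]mxE.
  rewrite !cX dotZl dotZr mxE; have [->|lm] := eqVneq l m; first by rewrite mulrA cc.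
  by rewrite orth ?mulr0.
exists X => // m.
have rX : r m *m X = X *m delta_mx m m.
  apply/matrixP => s t; rewrite -[LHS]mulr1.
  have E (A : 'M[C]_N) : A s t = (A *m ev t) s 0 by rewrite -colE [RHS]mxE.
  rewrite mulr1 E [RHS]E -!mulmxA cX -scalemxAr mul_delta_mx_cond.
  have [<-|tm] := eqVneq m t; first by rewrite rx cX.
  by rewrite rlx // scaler0 mulr0n mulmx0.
by rewrite -rX -mulmxA (mulmx1C XX) mulmx1.
Qed.

End Contraction.

(** * Images of the diagonal matrix units *)

Section Intertwine.
Variables (C : numClosedFieldType) (N : nat) (T : eqType) (blk : 'I_N -> T).
Hypothesis archi : forall x : C, 0 <= x -> exists k : nat, x <= k%:R.
Hypothesis N_ge3 : (2 < N)%N.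
Local Notation D := (@blockdiag C N T blk).
Local Notation supp := (@supported C N T blk).
Local Notation E m := (delta_mx m m : 'M[C]_N).

Lemma sum_delta : \sum_m E m = 1%:M.
Proof.
apply/matrixP => s t; rewrite summxE !mxE (bigD1 s) //= mxE eqxx /=.
rewrite big1 ?addr0 1?[t == s]eq_sym // => l /negPf ls.
by rewrite mxE eq_sym ls.
Qed.

Lemma blockdiag_E m : D (E m). Proof. exact: blockdiag_delta. Qed.

(** The difference of two unitaries that differ in one entry only is a
    multiple of a matrix unit by a sum of two unimodular numbers, and such
    sums generate all complex numbers additively. *)
Lemma unitary_span (G : 'M[C]_N -> Prop) :
  (forall u, D u -> u *m u^t* = 1%:M -> G u) ->
  (forall a b, D a -> D b -> G a -> G b -> G (a - b)) ->
  forall a, D a -> G a.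
Proof.
move=> Gu Gsub.
have G0 : G 0.
  have G1 : G 1%:M by apply: Gu; rewrite ?trmxC1 ?mulmx1 //; apply: blockdiag1.
  by rewrite -(subrr 1%:M); apply: Gsub => //; apply: blockdiag1.
have GN b : D b -> G b -> G (- b).
  by move=> Db Gb; rewrite -sub0r; apply: Gsub => //; apply: blockdiag0.
have GD b c : D b /\ G b -> D c /\ G c -> D (b + c) /\ G (b + c).
  move=> [Db Gb] [Dc Gc]; split; first exact: blockdiagD.
  by rewrite -[c]opprK; apply: Gsub => //; [apply: blockdiagN | apply: GN].
have DG0 : D 0 /\ G 0 by split=> //; apply: blockdiag0.
suff DGe s t c : blk s = blk t -> D (c *: delta_mx s t) /\ G (c *: delta_mx s t).
  move=> a Da; suff [] : D a /\ G a by [].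
  rewrite [a]matrix_sum_delta.
  apply: (big_ind (fun b => D b /\ G b)) => // s _.
  apply: (big_ind (fun b => D b /\ G b)) => // t _.
  have [st|st] := eqVneq (blk s) (blk t); first exact: DGe.
  by rewrite Da // scale0r.
move=> st.
(* a diagonal unitary followed by the transposition of s and t *)
pose U (w : C) : 'M[C]_N :=
  diag_mx (\row_i (if i == s then w else 1)) *m perm_mx (tperm s t).
have DU w : D (U w).
  apply: blockdiagM; first exact: blockdiag_diag.
  move=> i j ij; rewrite !mxE; case: eqVneq => // eij; case/eqP: ij.
  by rewrite -eij; case: tpermP => [->|->|].
have UU w : `|w| = 1 -> U w *m (U w)^t* = 1%:M.
  move=> w1; rewrite /U trmxC_mul mulmxA -(mulmxA (diag_mx _)).
  have -> : (perm_mx (tperm s t) : 'M[C]_N)^t* = perm_mx (tperm s t)^-1.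
    by rewrite tr_perm_mx map_perm_mx.
  rewrite -perm_mxM mulgV perm_mx1 mulmx1 tr_diag_mx map_diag_mx mulmx_diag.
  rewrite -diag_const_mx; congr diag_mx; apply/rowP => i; rewrite !mxE.
  by case: eqP => _; rewrite ?rmorph1 ?mulr1 // -normCK w1 expr1n.
have GU w1 w2 : `|w1| = 1 -> `|w2| = 1 ->
    D ((w1 + w2) *: delta_mx s t) /\ G ((w1 + w2) *: delta_mx s t).
  move=> h1 h2; split; first by apply: blockdiagZ; apply: blockdiag_delta.
  have -> : (w1 + w2) *: delta_mx s t = U w1 - U (- w2).
    rewrite /U !mul_diag_mx; apply/matrixP => i j; rewrite !mxE.
    have [->|is_] := eqVneq i s; last by rewrite !mul1r subrr mulr0.
    by rewrite tpermL [j == t]eq_sym; case: eqP => _; rewrite ?mulr1 ?mulr0; ring.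
  by apply: Gsub => //; apply: Gu => //; apply: UU; rewrite ?normrN.
have [k [w1 [w2 [h1 h2 ->]]]] := unimodular_multiple archi c.
rewrite -scalerMnl; elim: k => [|k IH]; first by rewrite mulr0n.
by rewrite mulrS; apply: GD => //; apply: GU.
Qed.

Variable Phi : 'M[C]_N -> 'M[C]_N.
Hypothesis Phi_add : {morph Phi : a b / a + b}.
Hypothesis Phi_D : forall a, D a -> D (Phi a).
Hypothesis Phi_surj : forall b, D b -> exists2 a, D a & Phi a = b.
Hypothesis Phi_pres : forall a b, D a -> D b -> sorth a b -> sorth b a ->
  sorth (Phi a) (Phi b).

Let N_gt0 : (0 < N)%N. Proof. by apply: ltn_trans N_ge3. Qed.

Let Phi0 := additive_map0 Phi_add.
Let PhiB := additive_mapB Phi_add.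
Let Phi_sum := additive_map_sum Phi_add.

Lemma orthogonal_ranges_preserved a b :
  D a -> D b -> b^t* *m a = 0 -> sorth (Phi a) (Phi b).
Proof.
move=> Da Db ba; apply: Phi_pres => //; apply: orthogonal_ranges_sorth => //.
by rewrite -[LHS]trmxCK trmxC_mul trmxCK ba trmxC0.
Qed.

(** The pieces q_m = Phi (E_m a) add up to the unitary u = Phi a, and each of
    them is mutually orthogonal to u - q_m; so [resolution_of_identity]
    applies to the q_m u^*. *)
Lemma unitary_resolution a : D a -> Phi a *m (Phi a)^t* = 1%:M ->
  exists2 X : 'M[C]_N, X^t* *m X = 1%:M &
    forall m, Phi (E m *m a) = X *m E m *m X^t* *m Phi a.
Proof.
move=> Da; set u := Phi a => uu; have u'u := mulmx1C uu.
pose q m := Phi (E m *m a).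
have sumq : \sum_m q m = u by rewrite /q -Phi_sum -mulmx_suml sum_delta mul1mx.
have DE m : D (E m *m a) by apply: blockdiagM => //; apply: blockdiag_E.
have DEc m : D (a - E m *m a) by apply: blockdiagB.
have qc m : u - q m = Phi (a - E m *m a) by rewrite PhiB.
have orth m : (a - E m *m a)^t* *m (E m *m a) = 0.
  rewrite trmxC_add trmxC_opp mulmxDl mulNmx trmxC_mul trmxC_delta -!mulmxA.
  by rewrite (mulmxA (E m)) mul_delta_mx subrr.
have so1 m : sorth (q m) (u - q m).
  by rewrite qc; apply: orthogonal_ranges_preserved.
have so2 m : sorth (u - q m) (q m).
  rewrite qc; apply: orthogonal_ranges_preserved => //.
  by rewrite -[LHS]trmxCK trmxC_mul trmxCK orth trmxC0.
have q0 m : q m != 0.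
  apply/eqP => qm0; have : Phi (a - E m *m a) = u by rewrite PhiB -/(q m) qm0 subr0.
  move=> h; have := preimage_row_neq0 N_ge3 Phi_add Phi_surj Phi_pres m (DEc m) h uu.
  case/eqP; apply/rowP => t; rewrite !mxE (bigD1 m) //= mxE !eqxx mul1r.
  rewrite big1 ?addr0 ?subrr // => l lm; by rewrite mxE eqxx (negPf lm) mul0r.
have nu (v : 'cV[C]_N) : nsq (u^t* *m v) = nsq v by rewrite nsq_isometry ?trmxCK.
have [X XX hX] : exists2 X : 'M[C]_N, X^t* *m X = 1%:M &
    forall m, q m *m u^t* = X *m E m *m X^t*.
  apply: resolution_of_identity => [|m v|m v|m].
  - by rewrite -mulmx_suml sumq.
  - have [h _] := sorth_contraction uu (subrKC (q m) u) (so1 m).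
    by rewrite -mulmxA; apply: le_trans (h _) _; rewrite nu.
  - have [h _] := sorth_contraction uu (subrK (q m) u) (so2 m).
    by rewrite -uu -mulmxBl -mulmxA; apply: le_trans (h _) _; rewrite nu.
  - have [_ [x hx x0]] := sorth_contraction uu (subrKC (q m) u) (so1 m).
    exists x; last exact: x0.
    by rewrite trmxC_mul trmxCK -mulmxA hx mulmxA uu mul1mx.
by exists X => // m; rewrite -hX -mulmxA u'u mulmx1.
Qed.

(** The orthonormal basis found by [unitary_resolution] does not depend on a:
    the ranges of E_l a0 and E_m a are orthogonal, hence so are those of their
    rank-one images. The conclusion is additive in Phi a, and unitaries
    generate all block-diagonal matrices additively. *)
Lemma intertwine : exists2 X : 'M[C]_N, X^t* *m X = 1%:M &
  forall m a, D a -> Phi (E m *m a) = X *m E m *m X^t* *m Phi a.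
Proof.
have [a0 Da0 Pa0] := Phi_surj (@blockdiag1 C N T blk).
have [|X0 XX0 hX0] := unitary_resolution Da0; first by rewrite Pa0 trmxC1 mulmx1.
have X0X := mulmx1C XX0.
have DE m a : D a -> D (E m *m a) by apply: blockdiagM; apply: blockdiag_E.
exists X0 => // m a Da; move: a Da.
suff H b : D b -> forall a, D a -> Phi a = b ->
    Phi (E m *m a) = X0 *m E m *m X0^t* *m Phi a.
  by move=> a Da; apply: (H (Phi a)) => //; apply: Phi_D.
apply: (unitary_span (G := fun b => forall a, D a -> Phi a = b ->
    Phi (E m *m a) = X0 *m E m *m X0^t* *m Phi a)) => {b}; last first.
  move=> b c Db Dc Hb Hc a Da Pa.
  have [a1 Da1 Pa1] := Phi_surj Db.
  have Da2 : D (a1 - a) by apply: blockdiagB.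
  have -> : Phi (E m *m a) = Phi (E m *m a1) - Phi (E m *m (a1 - a)).
    by rewrite -PhiB -mulmxBr subKr.
  rewrite (Hb _ Da1 Pa1) (Hc _ Da2) -?mulmxBr -?PhiB ?subKr //.
  by rewrite PhiB Pa Pa1 subKr.
move=> u Du uu a Da Pa; move: uu; rewrite -Pa => uu.
have [X XX hX] := unitary_resolution Da uu; rewrite hX; congr (_ *m _).
have X'X := mulmx1C XX.
have [W WE] : exists W, W = X^t* *m X0 by eexists.
(* W is the change of basis between the one for a0 and the one for a; its
   m-th row has a single nonzero entry. *)
have W0 l : l != m -> W m l = 0.
  move=> lm; have : sorth (Phi (E l *m a0)) (Phi (E m *m a)).
    apply: orthogonal_ranges_preserved; rewrite ?trmxC_mul ?trmxC_delta; try exact: DE.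
    by rewrite -mulmxA (mulmxA (E m)) mul_delta_mx_0 1?eq_sym // mul0mx mulmx0.
  rewrite hX0 hX Pa0 mulmx1 => -[y hy].
  have p0 : X0 *m E l *m X0^t* != 0.
    apply/eqP => /(congr1 (fun A => X0^t* *m A *m X0)).
    rewrite !mulmxA XX0 mul1mx -mulmxA XX0 mulmx1 mulmx0 mul0mx.
    by move/matrixP/(_ l l); rewrite !mxE eqxx => /eqP; rewrite oner_eq0.
  have := attains_neq0 hy p0; set al := (X0^t* *m y) l 0.
  have -> : X0 *m E l *m X0^t* *m y = al *: (X0 *m ev l).
    rewrite -!mulmxA scalemxAr; congr (_ *m _).
    rewrite -(mul_delta_mx (0 : 'I_1)) -mulmxA -rowE.
    by rewrite [X in _ *m X = _]mx11_scalar mul_mx_scalar mxE.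
  rewrite scaler_eq0 negb_or => /andP[al0 _].
  rewrite -scalemxAr => /eqP; rewrite scaler_eq0 (negPf al0) /= => /eqP.
  rewrite !trmxC_mul trmxCK trmxC_delta => /(congr1 (fun A => X^t* *m (Phi a *m A))).
  rewrite !mulmxA -(mulmxA (X^t*)) uu mulmx1 XX mul1mx mulmx0.
  rewrite -(mulmxA (E m)) -WE => /matrixP/(_ m 0).
  by rewrite -mulmxA -colE mxE (bigD1 m) //= !mxE !eqxx mul1r big1 ?addr0 //;
     move=> i im; rewrite !mxE eqxx (negPf im) mul0r.
have WW : W *m W^t* = 1%:M.
  by rewrite WE trmxC_mul trmxCK mulmxA -(mulmxA _ X0) X0X mulmx1.
have EW : E m *m W = W m m *: E m.
  apply/matrixP => s t; rewrite !mxE (bigD1 m) //= mxE eqxx andbT big1 ?addr0; last first.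
    by move=> i /negPf im; rewrite mxE im andbF mul0r.
  case: eqP => _; last by rewrite mul0r mulr0.
  rewrite mul1r; have [->|tm] := eqVneq t m; first by rewrite mulr1.
  by rewrite W0 ?mulr0.
have w1 : (W m m)^* * W m m = 1.
  have := congr1 (fun A : 'M_N => A m m) WW; rewrite !mxE eqxx (bigD1 m) //= big1 ?addr0.
    by rewrite !mxE mulrC.
  by move=> i im; rewrite W0 // mul0r.
have -> : X = X0 *m W^t* by rewrite WE trmxC_mul trmxCK mulmxA X0X mul1mx.
rewrite trmxC_mul trmxCK -!mulmxA; congr (_ *m _); rewrite !mulmxA; congr (_ *m _).
rewrite -[E m](mul_delta_mx m) mulmxA -mulmxA EW.
have -> : W^t* *m E m = (W m m)^* *: E m.
  by rewrite -[LHS]trmxCK trmxC_mul trmxCK trmxC_delta EW trmxC_scale trmxC_delta.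
by rewrite -scalemxAl -scalemxAr scalerA w1 scale1r mul_delta_mx.
Qed.
End Intertwine.

(** * Additive maps whose norm depends on the modulus *)

Section AdditiveNorm.
Variable C : numClosedFieldType.
Hypothesis archi : forall x : C, 0 <= x -> exists k : nat, x <= k%:R.

Lemma archi_le0 (x y : C) : 0 <= y -> x \is Num.real ->
  (forall k : nat, x *+ k <= y) -> x <= 0.
Proof.
move=> y0 xr h; rewrite real_leNgt ?real0 //; apply/negP => x0.
have [k hk] : exists k : nat, y / x <= k%:R by apply: archi; rewrite divr_ge0 // ltW.
have := h k.+1; rewrite -mulr_natr -ler_pdivlMl // mulrC => h1.
by have := le_trans h1 hk; rewrite ler_nat ltnn.
Qed.

(** Nonnegativity makes phi monotone, and a monotone additive function is
    squeezed between its values at integers. *)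
Lemma additive_nneg_linear (phi : C -> C) :
  (forall s, 0 <= s -> 0 <= phi s) ->
  (forall s s', 0 <= s -> 0 <= s' -> phi (s + s') = phi s + phi s') ->
  forall s, 0 <= s -> phi s = phi 1 * s.
Proof.
move=> pos add.
have p0 : phi 0 = 0 by apply: (addrI (phi 0)); rewrite -add ?addr0.
have pn k s : 0 <= s -> phi (s *+ k) = phi s *+ k.
  by move=> s0; elim: k => [|k IH]; rewrite ?mulr0n // !mulrS add ?mulrn_wge0 // IH.
have mono s s' : 0 <= s -> s <= s' -> phi s <= phi s'.
  move=> s0 ss'; have d0 : 0 <= s' - s by rewrite subr_ge0.
  by rewrite -(subrK s s') add // lerDr pos.
have up s : 0 <= s -> phi s <= phi 1 * s.
  move=> s0; rewrite -subr_le0; apply: (archi_le0 (pos 1 ler01)).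
    by rewrite rpredB // ?rpredM ?ger0_real ?pos.
  move=> k; have ks0 : 0 <= s *+ k by rewrite mulrn_wge0.
  have ex : exists p : nat, s *+ k <= p%:R by apply: archi.
  case: (ex_minnP ex) => p hp minp.
  have hp1 : p%:R <= s *+ k + 1.
    case: p hp minp => [|p] hp minp; first by rewrite addr_ge0.
    have lt : p%:R < s *+ k.
      by rewrite real_ltNge ?ger0_real //; apply/negP => /minp; rewrite ltnn.
    by rewrite mulrSr lerD2r ltW.
  rewrite mulrnBl -pn // -mulrnAr lerBlDl.
  apply: le_trans (mono _ _ ks0 hp) _.
  rewrite pn // -[X in X <= _]mulr_natr -[X in _ <= _ + X]mulr1 -mulrDr.
  by rewrite ler_wpM2l ?pos.
move=> s s0; apply/eqP; rewrite eq_le up //=.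
have [k hk] := archi s0.
have ks0 : 0 <= k%:R - s by rewrite subr_ge0.
have : phi k%:R <= phi 1 * (k%:R - s) + phi s.
  by rewrite -{1}(subrK s k%:R) add // lerD2r up.
by rewrite pn // -[X in X <= _]mulr_natr mulrBr -addrA lerDl addrC subr_ge0.
Qed.

(** For orthogonal c and c' the numbers c + c' and c - c' have the same
    modulus, so the parallelogram law turns the dependence of |f c|^2 on |c|^2
    into an additive function. *)
Lemma additive_norm_scale n (f : C -> 'rV[C]_n) :
  {morph f : x y / x + y} ->
  (forall c c', `|c| = `|c'| -> nsq (f c) = nsq (f c')) ->
  forall c, nsq (f c) = nsq (f 1) * `|c| ^+ 2.
Proof.
move=> fD fn c.
have fN := additive_mapN fD.
pose phi s := nsq (f (sqrtC s)).
have phiE x : nsq (f x) = phi (`|x| ^+ 2).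
  by apply: fn; rewrite [RHS]ger0_norm ?sqrtC_ge0 ?exprn_ge0 // sqrCK.
have -> : nsq (f 1) = phi 1 by rewrite /phi sqrtC1.
rewrite phiE; apply: additive_nneg_linear; rewrite ?exprn_ge0 //.
  by move=> s _; apply: nsq_ge0.
move=> s s' s0 s'0.
have r0 : 0 <= sqrtC s by rewrite sqrtC_ge0.
have r'0 : 0 <= sqrtC s' by rewrite sqrtC_ge0.
have e1 : `|sqrtC s + 'i * sqrtC s'| ^+ 2 = s + s'.
  rewrite normC2_rect ?ger0_real // !sqrtCK //.
have e2 : `|sqrtC s - 'i * sqrtC s'| ^+ 2 = s + s'.
  by rewrite -mulrN normC2_rect ?realN ?ger0_real // sqrrN !sqrtCK.
have e3 : `|'i * sqrtC s'| ^+ 2 = s'.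
  by rewrite normrM normCi mul1r ger0_norm // sqrtCK.
have h1 := phiE (sqrtC s + 'i * sqrtC s').
have h2 := phiE (sqrtC s - 'i * sqrtC s').
have h3 := phiE ('i * sqrtC s').
rewrite e1 fD nsqD in h1; rewrite e2 fD fN nsqB in h2; rewrite e3 in h3.
have : phi (s + s') + phi (s + s') = (phi s + phi s') + (phi s + phi s').
  by rewrite -{1}h1 -h2 -h3 /phi; ring.
by rewrite -!mulr2n => /pmulrnI; apply.
Qed.

End AdditiveNorm.

(** * Maps acting row by row *)

Section Rows.
Variables (C : numClosedFieldType) (N : nat) (T : eqType) (blk : 'I_N -> T).
Hypothesis archi : forall x : C, 0 <= x -> exists k : nat, x <= k%:R.
Hypothesis N_ge3 : (2 < N)%N.
Local Notation D := (@blockdiag C N T blk).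
Local Notation E m := (delta_mx m m : 'M[C]_N).

Definition in_row (m : 'I_N) (y : 'rV[C]_N) := forall t, blk t != blk m -> y 0 t = 0.

Lemma in_row_delta m t c : blk t = blk m -> in_row m (c *: er t).
Proof.
move=> tm s sm; rewrite !mxE; have [e|_] := eqVneq s t; last by rewrite mulr0.
by rewrite e tm eqxx in sm.
Qed.

Lemma in_rowD m y z : in_row m y -> in_row m z -> in_row m (y + z).
Proof. by move=> hy hz s sm; rewrite mxE hy ?hz ?addr0. Qed.

Lemma blockdiag_row m y : in_row m y -> D (ev m *m y).
Proof.
move=> hy s t st; rewrite mxE big_ord1 mxE.
have [e|//] := eqVneq s m; last by rewrite mul0r.
by rewrite hy ?mulr0 // -e eq_sym.
Qed.

Lemma dot_er (s t : 'I_N) : dot (er s : 'rV[C]_N) (er t) = (s == t)%:R.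
Proof.
rewrite /dot trmxC_delta mul_delta_mx; have [->|st] := eqVneq s t.
  rewrite /mxtrace (bigD1 t) //= mxE !eqxx big1 ?addr0 // => l lt.
  by rewrite mxE (negPf lt).
by rewrite /mxtrace big1 // => l _; rewrite mxE; case: eqVneq => // ->; rewrite (negPf st).
Qed.

Lemma nsq_er c (t : 'I_N) : nsq (c *: er t : 'rV[C]_N) = `|c| ^+ 2.
Proof. by rewrite nsqZ nsq_delta mulr1. Qed.

Lemma dot_er_neq (c c' : C) (s t : 'I_N) : s != t -> dot (c *: er s) (c' *: er t) = 0.
Proof. by move=> st; rewrite dotZl dotZr dot_er (negPf st) !mulr0. Qed.

Lemma third_index (a b : 'I_N) : exists c, c != a /\ c != b.
Proof.
have [/existsP[c]|/existsPn h] := boolP [exists c, c \notin [set a; b]].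
  by rewrite !inE negb_or => /andP[]; exists c.
have : (#|'I_N| <= #|[set a; b]|)%N.
  by apply: subset_leq_card; apply/fintype.subsetP => c _; have := h c; rewrite negbK.
by rewrite card_ord cards2 leqNgt (leq_ltn_trans _ N_ge3) //; case: (a != b).
Qed.

(** Norms will be compared between matrix units that differ both in row and in
    column. Through at most one intermediate unit this relation connects any
    two units, thanks to a third index. *)
Lemma unit_neighbour (m m' t t' : 'I_N) : blk m = blk t -> blk m' = blk t' ->
  (exists s r : 'I_N, blk s = blk r /\ [/\ s != m, s != m', r != t & r != t'])
  \/ (m != m' /\ t != t').
Proof.
move=> mt m't'.
have [mm'|mm'] := eqVneq (blk m) (blk m'); last first.
  by right; split; [move: mm' | move: mm'; rewrite mt m't']; apply: contraNneq => ->.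
left; have [/existsP[s sm]|/existsPn h] := boolP [exists s, blk s != blk m].
  have ne r : blk r = blk m -> s != r by move=> e; apply: contraNneq sm => ->; rewrite e.
  by exists s, s; rewrite !ne // ?mm' // -?mt -?m't' ?mm'.
have [s [s1 s2]] := third_index m m'; have [r [r1 r2]] := third_index t t'.
exists s, r; split=> //; have /negPn/eqP -> := h s.
by have /negPn/eqP -> := h r.
Qed.

Variable Psi : 'M[C]_N -> 'M[C]_N.
Hypothesis Psi_add : {morph Psi : a b / a + b}.
Hypothesis Psi_row : forall m a, D a -> Psi (E m *m a) = E m *m Psi a.
Hypothesis Psi_pres : forall a b, D a -> D b -> sorth a b -> sorth b a ->
  sorth (Psi a) (Psi b).
Hypothesis Psi_neq0 : forall m, exists2 a, D a & E m *m Psi a != 0.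

Definition psi (m : 'I_N) (y : 'rV[C]_N) : 'rV[C]_N := row m (Psi (ev m *m y)).

Lemma psiD m : {morph psi m : y z / y + z}.
Proof. by move=> y z; rewrite /psi mulmxDr Psi_add linearD. Qed.

Lemma psi0 m : psi m 0 = 0.
Proof. exact/additive_map0/psiD. Qed.

Lemma psi_sum m (I : finType) (P : pred I) (F : I -> 'rV[C]_N) :
  psi m (\sum_(i | P i) F i) = \sum_(i | P i) psi m (F i).
Proof. exact/additive_map_sum/psiD. Qed.

Lemma Psi_ev m y : in_row m y -> Psi (ev m *m y) = ev m *m psi m y.
Proof.
move=> hy; have := @Psi_row m _ (blockdiag_row hy).
rewrite mulmxA mul_delta_mx => {1}->.
by rewrite -[E m](mul_delta_mx (0 : 'I_1)) -mulmxA -rowE.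
Qed.

Lemma row_Psi m a : D a -> row m (Psi a) = psi m (row m a).
Proof.
move=> Da; rewrite /psi; have -> : ev m *m row m a = E m *m a.
  by rewrite rowE mulmxA mul_delta_mx.
by rewrite Psi_row // [RHS]rowE mulmxA mul_delta_mx -rowE.
Qed.

Lemma psi_neq0 m : exists c t, blk t = blk m /\ psi m (c *: er t) != 0.
Proof.
have [a Da am] := Psi_neq0 m.
have rm : psi m (row m a) != 0.
  rewrite -row_Psi //; apply: contraNneq am => h.
  by rewrite -[E m](mul_delta_mx (0 : 'I_1)) -mulmxA -rowE h mulmx0.
have [/existsP[t ht]|/existsPn h] := boolP [exists t, psi m (row m a 0 t *: er t) != 0].
  exists (row m a 0 t), t; split=> //; apply/eqP; apply: contraNT ht => tm.
  by rewrite mxE Da 1?eq_sym // scale0r psi0.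
case/eqP: rm; rewrite [row m a]row_sum_delta psi_sum big1 // => t _.
by have /negPn/eqP := h t.
Qed.

(** Let a have the rows y1, y2. Choose b with two orthogonal rows of equal
    length, one at m2 and one in a third place m3; then a and b are mutually
    orthogonal through the basis vectors m1 and m3. After applying Psi, the
    norm of Psi a must be attained at a vector that Psi a maps into the line
    m1; this forces the m1-row to dominate the m2-row and to be orthogonal to
    it. *)
Lemma psi_orth_le m1 m2 y1 y2 : m1 != m2 -> in_row m1 y1 -> in_row m2 y2 ->
  dot y1 y2 = 0 -> nsq y1 = nsq y2 ->
  dot (psi m1 y1) (psi m2 y2) = 0 /\ nsq (psi m2 y2) <= nsq (psi m1 y1).
Proof.
move=> m12 h1 h2 y12 ny; have [y10|y10] := eqVneq y1 0.
  have /eqP : nsq y2 == 0 by rewrite -ny y10 nsq0.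
  by move/eqP; rewrite nsq_eq0 y10 => /eqP ->; rewrite !psi0 dot0l nsq0.
have [c [t [tm2 pz]]] := psi_neq0 m2.
have [m3 [m31 m32]] := third_index m1 m2.
have [t' tt' t'm3] : exists2 t', t' != t & blk t' = blk m3.
  have [e|ne] := eqVneq t m3; last by exists m3 => //; rewrite eq_sym.
  by exists m2; [rewrite e eq_sym | rewrite -e tm2].
(* z is chosen with a nonzero image, and w orthogonal to z of the same
   length. *)
pose z : 'rV[C]_N := c *: er t; pose w : 'rV[C]_N := c *: er t'.
have hz : in_row m2 z by apply: in_row_delta.
have hw : in_row m3 w by apply: in_row_delta.
have zw : dot z w = 0 by rewrite dot_er_neq // eq_sym.
have w0 : w != 0.
  rewrite -nsq_eq0 nsq_er expf_eq0 normr_eq0 /=; apply: contraNneq pz => ->.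
  by rewrite scale0r psi0.
pose a := ev m1 *m y1 + ev m2 *m y2; pose b := ev m3 *m w + ev m2 *m z.
have Da : D a by apply: blockdiagD; apply: blockdiag_row.
have Db : D b by apply: blockdiagD; apply: blockdiag_row.
have oe (s s' : 'I_N) : s != s' -> dot (ev s : 'cV[C]_N) (ev s') = 0.
  by move=> ss; rewrite dot_ev mxE (negPf ss).
have oem (s s' : 'I_N) (y : 'rV[C]_N) : s != s' -> (ev s *m y)^t* *m ev s' = 0.
  by move=> ss; rewrite trmxC_mul -mulmxA mx11_dot oe // mul_mx_scalar scale0r.
have sab : sorth a b.
  exists (y1^t*).
    by apply: attains2; rewrite ?oe // ?nsq_delta ?ny // dotC y12 rmorph0.
  rewrite attains2_val; last by rewrite dotC y12 rmorph0.
  by rewrite -scalemxAr trmxC_add mulmxDl !oem // ?addr0 ?scaler0 // eq_sym.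
have sba : sorth b a.
  exists (w^t*).
    by apply: attains2; rewrite ?oe // !nsq_delta !mul1r !nsq_er.
  rewrite attains2_val // -scalemxAr trmxC_add mulmxDl !oem // ?addr0 ?scaler0 //.
    by rewrite eq_sym.
  by rewrite eq_sym.
have [Y [Y0 att]] := Psi_pres Da Db sab sba.
set A1 := psi m1 y1; set A2 := psi m2 y2.
have ea : Psi a = ev m1 *m A1 + ev m2 *m A2 by rewrite Psi_add !Psi_ev.
have eb : Psi b = ev m3 *m psi m3 w + ev m2 *m psi m2 z by rewrite Psi_add !Psi_ev.
have eav (v : 'cV[C]_N) : nsq (Psi a *m v) = nsq (A1 *m v) + nsq (A2 *m v).
  rewrite ea mulmxDl -!mulmxA nsqD_orth ?nsq_col_row ?nsq_delta ?mul1r //.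
  by rewrite dot_mull mulmxA mx11_dot oe // -scalemx1 scale0r mul0mx dot0r.
have oemu (s s' : 'I_N) (y : 'rV[C]_N) (u : 'M[C]_1) :
    s != s' -> (ev s *m y)^t* *m (ev s' *m u) = 0.
  by move=> ss; rewrite mulmxA oem // mul0mx.
have AY0 : (Psi b)^t* *m (Psi a *m Y) = 0 -> A2 *m Y = 0.
  rewrite ea mulmxDl -!mulmxA eb trmxC_add mulmxDl !mulmxDr.
  rewrite (oemu m3 m1) // (oemu m3 m2) // (oemu m2 m1) 1?eq_sym // !add0r.
  rewrite trmxC_mul -mulmxA trmxC_delta (mulmxA (delta_mx 0 m2)) mul_delta_mx.
  rewrite [delta_mx 0 0]mx11_scalar mxE eqxx mul1mx.
  rewrite [A2 *m Y]mx11_scalar mul_mx_scalar => /eqP; rewrite scaler_eq0.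
  case/orP => [/eqP -> //|]; first by rewrite -scalemx1 scale0r.
  by rewrite -nsq_eq0 nsq_trmxC nsq_eq0 (negPf pz).
move=> /AY0 {}AY0.
have hY : 0 < nsq Y by rewrite nsq_gt0.
have csY : nsq (A1 *m Y) <= nsq A1 * nsq Y.
  rewrite -[A1]trmxCK mx11_dot -scalemx1 nsqZ nsq_trmxC.
  have -> : nsq (1%:M : 'M[C]_1) = 1 by rewrite /nsq /dot trmxC1 mul1mx mxtrace1.
  by rewrite mulr1 cauchy_schwarz.
have key (v : 'cV[C]_N) : nsq (A1 *m v) + nsq (A2 *m v) <= nsq A1 * nsq v.
  rewrite -(ler_pM2r hY) -eav; apply: le_trans (att v) _.
  rewrite eav AY0 nsq0 addr0.
  by rewrite [leRHS]mulrAC ler_wpM2r // nsq_ge0.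
have n11 (c' : C) : nsq (c'%:M : 'M[C]_1) = `|c'| ^+ 2.
  by rewrite -scalemx1 nsqZ /nsq /dot trmxC1 mul1mx mxtrace1 mulr1.
have k1 := key (A1^t*); have k2 := key (A2^t*).
rewrite !mx11_row !n11 !nsq_trmxC in k1 k2.
split.
  rewrite -/(nsq A1) (ger0_norm (nsq_ge0 A1)) expr2 gerDl in k1.
  have /eqP : `|dot A1 A2| ^+ 2 == 0 by rewrite eq_le k1 exprn_ge0.
  by move/eqP; rewrite expf_eq0 normr_eq0 => /eqP.
rewrite -/(nsq A2) (ger0_norm (nsq_ge0 A2)) expr2 in k2.
have [->|A20] := eqVneq A2 0; first by rewrite nsq0 nsq_ge0.
have hA2 : 0 < nsq A2 by rewrite nsq_gt0.
rewrite -(ler_pM2r hA2); apply: le_trans k2.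
by rewrite lerDr mulr_ge0.
Qed.

Lemma psi_orth m1 m2 y1 y2 : m1 != m2 -> in_row m1 y1 -> in_row m2 y2 ->
  dot y1 y2 = 0 -> nsq y1 = nsq y2 -> dot (psi m1 y1) (psi m2 y2) = 0.
Proof. by move=> *; case: (@psi_orth_le m1 m2 y1 y2). Qed.

Lemma psi_nsq m1 m2 y1 y2 : m1 != m2 -> in_row m1 y1 -> in_row m2 y2 ->
  dot y1 y2 = 0 -> nsq y1 = nsq y2 -> nsq (psi m1 y1) = nsq (psi m2 y2).
Proof.
move=> m12 h1 h2 y12 ny; apply/eqP; rewrite eq_le.
have [_ ->] := psi_orth_le m12 h1 h2 y12 ny.
rewrite andbT; rewrite eq_sym in m12.
by have [] := @psi_orth_le m2 m1 y2 y1 m12 h2 h1; rewrite // dotC y12 rmorph0.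
Qed.

Lemma psi_unit_nsq m m' t t' c c' : blk m = blk t -> blk m' = blk t' ->
  `|c| = `|c'| -> nsq (psi m (c *: er t)) = nsq (psi m' (c' *: er t')).
Proof.
move=> mt m't' cc.
have adj a b x y e e' : a != b -> x != y -> blk a = blk x -> blk b = blk y ->
    `|e| = `|e'| -> nsq (psi a (e *: er x)) = nsq (psi b (e' *: er y)).
  move=> ab xy ax bY ee; apply: psi_nsq => //; try exact: in_row_delta.
    exact: dot_er_neq.
  by rewrite !nsq_er ee.
have [[s [r [sr [s1 s2 r1 r2]]]]|[h1 h2]] := unit_neighbour mt m't'; last exact: adj.
rewrite (adj m s t r c c') // 1?eq_sym //; exact: adj.
Qed.

(** By [psi_orth_le] and [unit_neighbour] the norm of the image of c times a
    matrix unit depends on the modulus of c only, so [additive_norm_scale]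
    applies. A row with two nonzero entries is compared with a neighbour of
    both. *)
Lemma psi_norm : exists g : C, [/\ 0 < g,
  forall m t c, blk m = blk t -> nsq (psi m (c *: er t)) = g * `|c| ^+ 2 &
  forall m t t' c c', blk m = blk t -> blk m = blk t' -> t != t' ->
     nsq (psi m (c *: er t + c' *: er t')) = g * (`|c| ^+ 2 + `|c'| ^+ 2)].
Proof.
have m0 : 'I_N by apply: (@Ordinal _ 0); apply: ltn_trans N_ge3.
pose g := nsq (psi m0 (1 *: er m0)); exists g.
have one m t c : blk m = blk t -> nsq (psi m (c *: er t)) = g * `|c| ^+ 2.
  move=> mt; rewrite (@additive_norm_scale _ archi _ (fun c => psi m (c *: er t))).
  - by rewrite (@psi_unit_nsq _ m0 _ m0 _ 1).
  - by move=> x y; rewrite scalerDl psiD.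
  - by move=> x y xy; apply: psi_unit_nsq.
split=> //.
  rewrite lt_def nsq_ge0 andbT; apply/eqP => g0.
  have [c [t [tm]]] := psi_neq0 m0.
  by rewrite -nsq_eq0 one // g0 mul0r eqxx.
move=> m t t' c c' mt mt' tt'.
have [[s [r [sr [s1 _ r1 r2]]]]|[]] := unit_neighbour mt mt'; last by rewrite eqxx.
pose e := sqrtC (`|c| ^+ 2 + `|c'| ^+ 2).
have e2 : `|e| ^+ 2 = `|c| ^+ 2 + `|c'| ^+ 2.
  by rewrite ger0_norm ?sqrtCK // sqrtC_ge0 addr_ge0 ?exprn_ge0.
rewrite -e2 -(one s r e sr); apply: psi_nsq.
- by rewrite eq_sym.
- by apply: in_rowD; apply: in_row_delta.
- exact: in_row_delta.
- by rewrite dotDl !dot_er_neq ?addr0 // eq_sym.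
- by rewrite nsqD_orth ?dot_er_neq // !nsq_er e2.
Qed.

End Rows.

(** * Additive isometries of the complex plane *)

Section ConjIf.
Variable C : numClosedFieldType.

Definition conj_if (b : bool) (c : C) : C := if b then c^* else c.

Lemma conj_if0 b : conj_if b 0 = 0.
Proof. by case: b; rewrite /conj_if ?conjC0. Qed.

Lemma conj_if1 b : conj_if b 1 = 1.
Proof. by case: b; rewrite /conj_if ?conjC1. Qed.

Lemma conj_ifN b c : conj_if b (- c) = - conj_if b c.
Proof. by case: b; rewrite /conj_if ?rmorphN. Qed.

Lemma conj_ifK b c : conj_if b (conj_if b c) = c.
Proof. by case: b; rewrite /conj_if ?conjCK. Qed.

Lemma conj_if_i_inj b b' : conj_if b 'i = conj_if b' 'i -> b = b'.
Proof.
have ne : - 'i != 'i :> C.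
  by rewrite -subr_eq0 -opprD oppr_eq0 -mulr2n mulrn_eq0 /= neq0Ci.
case: b b' => [] [] //; rewrite /conj_if conjCi => /eqP; rewrite ?(negPf ne) //.
by rewrite eq_sym (negPf ne).
Qed.

(** By polarisation f preserves the real inner product; f 'i / f 1 is then a
    unimodular number orthogonal to 1. *)
Lemma additive_isometry (f : C -> C) :
  {morph f : x y / x + y} -> (forall c, `|f c| = `|c|) ->
  exists b, forall c, f c = f 1 * conj_if b c.
Proof.
move=> fD fn.
have polar x y : f x * (f y)^* + (f x)^* * f y = x * y^* + x^* * y.
  have := congr1 (fun z => z ^+ 2) (fn (x + y)); rewrite fD !normCK !rmorphD /=.
  rewrite !mulrDl !mulrDr -!normCK !fn => h.
  apply: (addrI (`|x| ^+ 2 + `|y| ^+ 2)); move: h; rewrite !normCK => h.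
  transitivity (x * x^* + f x * (f y)^* + (f y * (f x)^* + y * y^*)); first by ring.
  by rewrite h; ring.
pose a := f 1; have aa : a * a^* = 1 by rewrite -normCK fn normr1 expr1n.
pose h c := a^* * f c.
have fh c : f c = a * h c by rewrite /h mulrA aa mul1r.
have hre c : h c + (h c)^* = c + c^*.
  have := polar c 1; rewrite conjC1 !mulr1 => <-.
  by rewrite /h rmorphM /= conjCK -/a; ring.
have hh x y : h x * (h y)^* = f x * (f y)^*.
  rewrite /h rmorphM /= conjCK; transitivity (a * a^* * (f x * (f y)^*)); first by ring.
  by rewrite aa mul1r.
set j := h 'i; have jN : j^* = - j.
  by apply/eqP; rewrite -addr_eq0 addrC hre conjCi subrr.
have jj : (j - 'i) * (j + 'i) = 0.
  have : j * j^* = 1 by rewrite hh -normCK fn normCi expr1n.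
  rewrite jN mulrN => e; transitivity (j * j - 'i * 'i); first by ring.
  by rewrite -[j * j]opprK e -expr2 sqrCi; ring.
have him c : j * (h c - (h c)^*) = 'i * (c - c^*).
  have hh' x y : (h x)^* * h y = (f x)^* * f y.
    by have := congr1 Num.conj (hh x y); rewrite !rmorphM /= !conjCK.
  have := polar c 'i; rewrite -hh -hh' -/j jN conjCi => e; apply: oppr_inj.
  by transitivity (h c * - j + (h c)^* * j); [ring | rewrite e; ring].
have two x y : x + x = y + y -> x = y :> C.
  by rewrite -!mulr2n => /pmulrnI; apply.
have i0 : 'i != 0 :> C by rewrite neq0Ci.
move/eqP: jj; rewrite mulf_eq0 => /orP[]; rewrite ?subr_eq0 ?addr_eq0 => /eqP ej.
  exists false => c; rewrite fh /conj_if; congr (_ * _); apply: two.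
  have := him c; rewrite ej => /(mulfI i0) e.
  transitivity ((h c - (h c)^*) + (h c + (h c)^*)); first by ring.
  by rewrite e hre; ring.
exists true => c; rewrite fh /conj_if; congr (_ * _); apply: two.
have := him c; rewrite ej mulNr -mulrN => /(mulfI i0) e.
transitivity ((h c + (h c)^*) - (- (h c - (h c)^*))); first by ring.
by rewrite e hre; ring.
Qed.

End ConjIf.

(** * Row maps fixing the diagonal matrix units *)

Section Monomial.
Variables (C : numClosedFieldType) (N : nat) (T : eqType) (blk : 'I_N -> T).
Local Notation in_row := (@in_row C N T blk).
Variable om : 'I_N -> 'rV[C]_N -> 'rV[C]_N.
Hypothesis omD : forall m, {morph om m : y z / y + z}.
Hypothesis om_id : forall m, om m (er m) = er m.
Hypothesis om_orth : forall m1 m2 y1 y2, m1 != m2 -> in_row m1 y1 -> in_row m2 y2 ->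
  dot y1 y2 = 0 -> nsq y1 = nsq y2 -> dot (om m1 y1) (om m2 y2) = 0.
Hypothesis om_nsq : forall m t c, blk m = blk t -> nsq (om m (c *: er t)) = `|c| ^+ 2.
Hypothesis om_nsq2 : forall m t t' c c', blk m = blk t -> blk m = blk t' -> t != t' ->
  nsq (om m (c *: er t + c' *: er t')) = `|c| ^+ 2 + `|c'| ^+ 2.

Lemma dot_erl (s : 'I_N) (y : 'rV[C]_N) : dot (er s) y = y 0 s.
Proof.
by rewrite /dot trmxC_delta mxtrace_mulC -[y *m _]colE trace_mx11 mxE.
Qed.

Let om_polar m t c c' : blk m = blk t ->
  dot (om m (c *: er t)) (om m (c' *: er t)) +
  (dot (om m (c *: er t)) (om m (c' *: er t)))^* = c^* * c' + c * c'^*.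
Proof.
move=> mt; have := om_nsq (c + c') mt; rewrite scalerDl omD nsqD !om_nsq // => h.
apply: (addrI (`|c| ^+ 2 + `|c'| ^+ 2)); rewrite h !normCK rmorphD /=; ring.
Qed.

Let om_real m t (r c : C) : r \is Num.real -> blk m = blk t ->
  om m ((r * c) *: er t) = r *: om m (c *: er t).
Proof.
move=> rr mt; have rc : r^* = r by apply/CrealP.
apply/eqP; rewrite -subr_eq0 -nsq_eq0 nsqB nsqZ !om_nsq // dotZr rmorphM /= rc -mulrDr.
rewrite om_polar // normrM exprMn (real_normK rr) rmorphM /= rc !normCK.
by apply/eqP; ring.
Qed.

Let om_off m t c s : blk m = blk t -> s != m -> s != t -> om m (c *: er t) 0 s = 0.
Proof.
move=> mt sm st; have [->|c0] := eqVneq c 0.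
  rewrite scale0r; have -> : om m 0 = 0 by apply: (addrI (om m 0)); rewrite -omD !addr0.
  by rewrite mxE.
have nr : `|c| \is Num.real by rewrite normr_real.
have := @om_orth s m (`|c| *: er s) (c *: er t) sm.
have -> : om s (`|c| *: er s) = `|c| *: er s.
  by rewrite -{1}[`|c|]mulr1 om_real // scale1r om_id.
move=> h; have nn : nsq (`|c| *: er s : 'rV[C]_N) = nsq (c *: er t) by rewrite !nsq_er normr_id.
have := h (in_row_delta _ erefl) (in_row_delta _ (esym mt)) (dot_er_neq _ _ st) nn.
move/eqP; rewrite dotZl dot_erl.
by rewrite mulf_eq0 conjC_eq0 normr_eq0 (negPf c0) => /eqP.
Qed.

Definition theta m t (c : C) : C := om m (c *: er t) 0 t.

Let thetaD m t : {morph theta m t : x y / x + y}.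
Proof. by move=> x y; rewrite /theta scalerDl omD mxE. Qed.

Let om_diag m c : om m (c *: er m) = theta m m c *: er m.
Proof.
apply/rowP => s; rewrite mxE; have [->|sm] := eqVneq s m.
  by rewrite mxE !eqxx mulr1.
by rewrite om_off // mxE (negPf sm) andbF mulr0.
Qed.

Let theta_diag m : exists b, forall c, theta m m c = conj_if b c.
Proof.
have t1 : theta m m 1 = 1 by rewrite /theta scale1r om_id mxE !eqxx.
have [|b hb] := additive_isometry (thetaD m m).
  move=> c; apply: (@pexpIrn _ 2) => //; rewrite ?nnegrE //.
  by rewrite -(@om_nsq m m c) // om_diag nsq_er.
by exists b => c; rewrite hb t1 mul1r.
Qed.

(** Orthogonality to the fixed rows e_s confines the image to the coordinates
    m and t. Its component along e_m vanishes because the norms of two-entry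
    rows in row m are additive. *)
Lemma om_er m t c : blk m = blk t -> om m (c *: er t) = theta m t c *: er t.
Proof.
move=> mt; have [<-|tm] := eqVneq m t; first exact: om_diag.
apply/rowP => s; rewrite mxE; have [->|st] := eqVneq s t.
  by rewrite mxE !eqxx mulr1.
rewrite [X in _ * X]mxE (negPf st) andbF mulr0.
have [->|sm] := eqVneq s m; last exact: om_off.
set X := om m (c *: er t) 0 m.
(* The row c e_t + c' e_m, with c' such that c' e_m is mapped to X e_m. *)
have [b hb] := theta_diag m.
have := @om_nsq2 m t m c (conj_if b X) mt erefl; rewrite eq_sym => /(_ tm).
rewrite omD nsqD !om_nsq // om_diag hb conj_ifK dotZr (dotC (er m)) dot_erl -/X.
have nr : (`|X| ^+ 2)^* = `|X| ^+ 2.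
  by apply/CrealP; apply: ger0_real; rewrite exprn_ge0.
rewrite -[RHS]addr0 => /addrI; rewrite -normCK nr -mulr2n.
by move/eqP; rewrite mulrn_eq0 /= expf_eq0 normr_eq0 => /eqP.
Qed.

Let theta_norm m t c : blk m = blk t -> `|theta m t c| = `|c|.
Proof.
move=> mt; apply: (@pexpIrn _ 2) => //; rewrite ?nnegrE //.
by rewrite -(@om_nsq m t c) // om_er // nsq_er.
Qed.

Let coef m t := theta m t 1.
Let is_conj m t := theta m t 'i == - ('i * coef m t).

Let coef_norm m t : blk m = blk t -> `|coef m t| = 1.
Proof. by move=> mt; rewrite theta_norm // normr1. Qed.

Let coef_neq0 m t : blk m = blk t -> coef m t != 0.
Proof. by move=> mt; rewrite -normr_eq0 coef_norm // oner_eq0. Qed.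

Let thetaE m t c : blk m = blk t -> theta m t c = coef m t * conj_if (is_conj m t) c.
Proof.
move=> mt; have [b hb] := additive_isometry (thetaD m t) (fun c => theta_norm c mt).
suff -> : is_conj m t = b by [].
rewrite /is_conj hb -/(coef m t) /conj_if; have k0 := coef_neq0 mt.
case: b {hb}; first by rewrite conjCi mulrN mulrC eqxx.
apply/negbTE; rewrite -addr_eq0 [X in _ + X]mulrC -mulr2n mulrn_eq0 /=.
by rewrite mulf_neq0 ?neq0Ci.
Qed.

Let cross m m' t t' (c1 c2 w : C) :
  blk m = blk t -> blk m' = blk t -> blk m = blk t' -> m != m' -> t != t' ->
  `|c1| = 1 -> `|c2| = 1 -> `|w| = 1 ->
  (theta m t c1)^* * theta m' t (c1 * w) = (theta m t' c2)^* * theta m' t' (c2 * w).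
Proof.
move=> mt m't mt' mm' tt' n1 n2 nw.
have m't' : blk m' = blk t' by rewrite m't -mt.
have cc (c : C) : `|c| = 1 -> c^* * c = 1 by move=> e; rewrite mulrC -normCK e expr1n.
have := @om_orth m m' (c1 *: er t + c2 *: er t')
  ((c1 * w) *: er t + (- (c2 * w)) *: er t') mm'.
have t't : t' != t by rewrite eq_sym.
rewrite !dotDl !dotDr !dotZl !dotZr !dot_er !eqxx (negPf tt') (negPf t't).
rewrite !omD !om_er // !dotDl !dotDr !dotZl !dotZr !dot_er !eqxx (negPf tt') (negPf t't).
have -> : theta m' t' (- (c2 * w)) = - theta m' t' (c2 * w).
  by rewrite !thetaE // conj_ifN mulrN.
rewrite !mulr1 !mulr0 !addr0 !add0r !mulrN => h; apply/eqP; rewrite -subr_eq0; apply/eqP.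
apply: h.
- by apply: in_rowD; apply: in_row_delta; rewrite ?mt' -?mt.
- by apply: in_rowD; apply: in_row_delta; rewrite // ?m't'.
- by rewrite !mulrA !cc // !mul1r subrr.
- by rewrite !nsqD_orth ?dot_er_neq // !nsq_er normrN !normrM n1 n2 nw mul1r.
Qed.

Let coef_cross m m' t t' :
  blk m = blk t -> blk m' = blk t -> blk m = blk t' -> m != m' -> t != t' ->
  (coef m t)^* * coef m' t = (coef m t')^* * coef m' t'.
Proof.
move=> mt m't mt' mm' tt'.
by have := @cross m m' t t' 1 1 1; rewrite !mulr1 normr1; apply.
Qed.

Let is_conj_row m t t' : blk m = blk t -> blk m = blk t' -> is_conj m t = is_conj m t'.
Proof.
move=> mt mt'; have [->//|tt'] := eqVneq t t'.
(* Compare row m with another row of the block, namely t or t'. *)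
have [m' [m'm m't]] : exists m', m' != m /\ blk m' = blk t.
  have [e|ne] := eqVneq m t; last by exists t; rewrite eq_sym.
  by exists t'; rewrite e eq_sym -mt' mt.
have m't' : blk m' = blk t' by rewrite m't -mt.
have h1 := coef_cross m't mt m't' m'm tt'.
have := @cross m' m t t' 1 1 'i; rewrite normr1 normCi !mul1r.
move=> /(_ m't mt m't' m'm tt' erefl erefl erefl).
rewrite !thetaE // !mulrA -/(coef m t) !conj_if1 !mulr1 h1 => /mulfI.
move=> /(_ _)/conj_if_i_inj; apply.
by rewrite mulf_neq0 ?conjC_eq0 ?coef_neq0.
Qed.

Let is_conj_col m m' t : blk m = blk t -> blk m' = blk t -> is_conj m t = is_conj m' t.
Proof.
move=> mt m't; have [->//|mm'] := eqVneq m m'.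
have [t' [tt' t't]] : exists t', t' != t /\ blk t' = blk t.
  have [e|ne] := eqVneq m t; last by exists m.
  by exists m'; split; rewrite // -e eq_sym.
have mt' : blk m = blk t' by rewrite t't.
have m't' : blk m' = blk t' by rewrite t't.
have h1 := coef_cross mt' m't' mt mm' tt'.
have := @cross m m' t' t 1 'i 1; rewrite normr1 normCi !mulr1.
move=> /(_ mt' m't' mt mm' tt' erefl erefl erefl).
rewrite !thetaE // !conj_if1 !mulr1 h1 rmorphM mulrACA -[LHS]mulr1 => /mulfI.
have k0 : (coef m t)^* * coef m' t != 0 by rewrite mulf_neq0 ?conjC_eq0 ?coef_neq0.
move=> /(_ k0) e; apply: (@conj_if_i_inj C).
have ni : conj_if (is_conj m t) 'i * (conj_if (is_conj m t) 'i)^* = 1 :> C.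
  rewrite -normCK; case: (is_conj m t); by rewrite /conj_if ?norm_conjC normCi expr1n.
have := congr1 (fun z => z * conj_if (is_conj m' t) 'i) ni.
by rewrite /= mul1r -mulrA -e mulr1.
Qed.

(** Images of the rows (c1, c2) and (c1 w, - c2 w) at two different places are
    orthogonal for unimodular c1, c2, w. This makes the coefficients of the
    matrix units multiplicative, that is, of the form d_m conj d_t, and forces
    all entries of a block to be conjugated simultaneously. *)
Lemma om_form : exists (d : 'I_N -> C) (tau : T -> bool),
  (forall m, `|d m| = 1) /\
  forall m t c, blk m = blk t ->
    om m (c *: er t) = (d m * (d t)^* * conj_if (tau (blk m)) c) *: er t.
Proof.
pose rep m := odflt m [pick s | blk s == blk m].
have repP m : blk m = blk (rep m).
  by rewrite /rep; case: pickP => [s /eqP|/(_ m)]; rewrite ?eqxx.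
have rep_eq m t : blk m = blk t -> rep m = rep t.
  move=> mt; rewrite /rep mt; case: pickP => // /(_ t); by rewrite eqxx.
have k1 m : coef m m = 1 by rewrite /coef /theta scale1r om_id mxE !eqxx.
exists (fun m => coef m (rep m)), (fun j => [exists m, (blk m == j) && is_conj m m]).
split=> [m|m t c mt]; first exact: coef_norm.
rewrite om_er // thetaE //; congr ((_ * conj_if _ c) *: _).
  have mr := repP m; have tr := repP t; rewrite -(rep_eq m t) //.
  have tr' : blk t = blk (rep m) by rewrite -mt.
  have [->|tr1] := eqVneq t (rep m); first by rewrite k1 conjC1 mulr1.
  have [<-|tm] := eqVneq m t.
    by rewrite k1 -normCK coef_norm // expr1n.
  have := @coef_cross t m t (rep m); rewrite k1 conjC1 mul1r mulrC => -> //.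
  by rewrite eq_sym.
have tt m' : blk m' = blk m -> is_conj m' m' = is_conj m t.
  by move=> e; rewrite (is_conj_row (t' := t)) ?e // (is_conj_col (m' := m)) ?e.
by apply/idP/existsP => [h|[m' /andP[/eqP e]]]; [exists m; rewrite eqxx tt | rewrite tt].
Qed.

End Monomial.

(** * Preservers on block-diagonal matrices *)

Section Core.
Variables (C : numClosedFieldType) (N : nat) (T : eqType) (blk : 'I_N -> T).
Hypothesis archi : forall x : C, 0 <= x -> exists k : nat, x <= k%:R.
Hypothesis N_ge3 : (2 < N)%N.
Local Notation D := (@blockdiag C N T blk).
Variable Phi : 'M[C]_N -> 'M[C]_N.
Hypothesis Phi_add : {morph Phi : a b / a + b}.
Hypothesis Phi_D : forall a, D a -> D (Phi a).
Hypothesis Phi_surj : forall b, D b -> exists2 a, D a & Phi a = b.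
Hypothesis Phi_pres : forall a b, D a -> D b -> sorth a b -> sorth b a ->
  sorth (Phi a) (Phi b).

Definition conj_blocks (tau : T -> bool) (a : 'M[C]_N) : 'M[C]_N :=
  \matrix_(s, t) conj_if (tau (blk s)) (a s t).

(** In the orthonormal basis of [intertwine] the map acts row by row. Dividing
    by the image of 1, which is a multiple of a unitary since its rows are
    orthogonal of equal length, makes the diagonal matrix units fixed, and
    [om_form] applies. *)
Lemma core_form : exists (X : 'M[C]_N) (g : C) (tau : T -> bool),
  [/\ X^t* *m X = 1%:M, 0 < g, Phi 1%:M *m (Phi 1%:M)^t* = g%:M &
      forall a, D a -> Phi a = X *m conj_blocks tau a *m X^t* *m Phi 1%:M].
Proof.
have [X0 XX0 hX0] := intertwine archi N_ge3 Phi_add Phi_D Phi_surj Phi_pres.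
have X0X := mulmx1C XX0.
pose Psi a := X0^t* *m Phi a.
have PhiE a : Phi a = X0 *m Psi a by rewrite /Psi mulmxA X0X mul1mx.
have Psi_add : {morph Psi : a b / a + b} by move=> a b; rewrite /Psi Phi_add mulmxDr.
have Psi_row m a : D a -> Psi (delta_mx m m *m a) = delta_mx m m *m Psi a.
  by move=> Da; rewrite /Psi hX0 // !mulmxA XX0 mul1mx.
have Psi_pres a b : D a -> D b -> sorth a b -> sorth b a -> sorth (Psi a) (Psi b).
  by move=> *; apply: sorth_mull; [rewrite trmxCK | apply: Phi_pres].
have Psi_neq0 m : exists2 a, D a & delta_mx m m *m Psi a != 0.
  have [a Da Pa] := Phi_surj (@blockdiag1 C N T blk).
  exists a => //; rewrite /Psi Pa mulmx1; apply/eqP.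
  move/(congr1 (mulmx^~ X0)); rewrite /= -mulmxA XX0 mulmx1 mul0mx.
  by move/matrixP/(_ m m); rewrite !mxE !eqxx => /eqP; rewrite oner_eq0.
have [g [g0 n1 n2]] := psi_norm archi N_ge3 Psi_add Psi_row Psi_pres Psi_neq0.
have orth := psi_orth N_ge3 Psi_add Psi_row Psi_pres Psi_neq0.
have D1 : D 1%:M by apply: blockdiag1.
have [G GE] : exists G, G = Psi 1%:M by eexists.
have rG m : row m G = psi Psi m (er m).
  by rewrite GE (row_Psi Psi_row) // row1.
have GG : G *m G^t* = g%:M.
  apply/matrixP => s t; have -> : (G *m G^t*) s t = dot (row t G) (row s G).
    by rewrite dotE !mxE exchange_big big_ord1; apply: eq_bigr => i _; rewrite !mxE mulrC.
  rewrite !rG !mxE; have [->|st] := eqVneq s t.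
    by have := n1 t t 1 erefl; rewrite scale1r normr1 expr1n mulr1.
  rewrite eq_sym in st; apply: orth => //.
  - by rewrite -[er t]scale1r; apply: in_row_delta.
  - by rewrite -[er s]scale1r; apply: in_row_delta.
  - by rewrite dot_er (negPf st).
  - by rewrite !nsq_delta.
have gn0 : g != 0 by rewrite gt_eqF.
have G'G : G^t* *m G = g%:M.
  have : g^-1 *: G^t* *m G = 1%:M.
    by apply: mulmx1C; rewrite -scalemxAr GG scale_scalar_mx mulVf.
  move/(congr1 (fun A => g *: A)); rewrite -scalemxAl scalerA mulfV // scale1r => ->.
  by rewrite scale_scalar_mx mulr1.
have gr : g^* = g by apply/CrealP; apply: gtr0_real.
pose om m y := g^-1 *: (psi Psi m y *m G^t*).
have omE m y : psi Psi m y = om m y *m G.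
  by rewrite /om -scalemxAl -mulmxA G'G mul_mx_scalar scalerA mulVf // scale1r.
have dom m m' y y' : dot (om m y) (om m' y') = g^-1 * dot (psi Psi m y) (psi Psi m' y').
  rewrite /om dotZl dotZr fmorphV /= gr -(dot_trmxC (_ *m G^t*)) !trmxC_mul trmxCK.
  by rewrite dot_mull mulmxA G'G mul_scalar_mx dotZr dot_trmxC mulKf.
have psiZ0 m : psi Psi m 0 = 0 by apply: psi0.
have omD m : {morph om m : y z / y + z}.
  by move=> y z; rewrite /om (psiD Psi_add) mulmxDl scalerDr.
have om_id m : om m (er m) = er m.
  by rewrite /om -rG -row_mul GG -scalemx1 linearZ /= row1 scalerA mulVf ?scale1r.
have [d [tau [d1 hom]]] : exists (d : 'I_N -> C) (tau : T -> bool),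
  (forall m, `|d m| = 1) /\
  forall m t c, blk m = blk t ->
    om m (c *: er t) = (d m * (d t)^* * conj_if (tau (blk m)) c) *: er t.
  apply: om_form => //.
  - by move=> m1 m2 y1 y2 m12 h1 h2 h12 n12; rewrite dom orth ?mulr0.
  - by move=> m t c mt; rewrite /nsq dom [dot _ _]n1 // mulKf.
  - by move=> m t t' c c' mt mt' tt'; rewrite /nsq dom [dot _ _]n2 // mulKf.
pose Dl := diag_mx (\row_m d m).
have DlDl : Dl *m Dl^t* = 1%:M.
  rewrite /Dl tr_diag_mx map_diag_mx mulmx_diag -diag_const_mx; congr diag_mx.
  by apply/rowP => i; rewrite !mxE -normCK d1 expr1n.
have PsiE a : D a -> Psi a = Dl *m conj_blocks tau a *m Dl^t* *m G.
  move=> Da; apply/row_matrixP => m; rewrite (row_Psi Psi_row) // omE row_mul.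
  congr (_ *m _); rewrite [row m a]row_sum_delta.
  rewrite (big_morph (om m) (omD m) (_ : om m 0 = 0)); last first.
    by rewrite /om psiZ0 mul0mx scaler0.
  rewrite [RHS]row_sum_delta; apply: eq_bigr => t _; rewrite [row m a _ _]mxE.
  have -> : row m (Dl *m conj_blocks tau a *m Dl^t*) 0 t =
      d m * (d t)^* * conj_if (tau (blk m)) (a m t).
    by rewrite mxE /Dl tr_diag_mx map_diag_mx mul_mx_diag mul_diag_mx !mxE mulrAC.
  have [mt|mt] := eqVneq (blk m) (blk t); first exact: hom.
  by rewrite Da // conj_if0 mulr0 !scale0r /om psiZ0 mul0mx scaler0.
exists (X0 *m Dl), g, tau; split=> //.
- by rewrite trmxC_mul mulmxA -(mulmxA (Dl^t*)) XX0 mulmx1; apply: mulmx1C.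
- rewrite PhiE -GE trmxC_mul mulmxA -(mulmxA X0) GG mul_mx_scalar -scalemxAl X0X.
  by rewrite scale_scalar_mx mulr1.
- move=> a Da; rewrite [LHS]PhiE PsiE // PhiE -GE trmxC_mul.
  by rewrite !mulmxA -(mulmxA _ (X0^t*) X0) XX0 mulmx1.
Qed.
End Core.

(** * The direct sum as an algebra of block-diagonal matrices *)

Local Open Scope complex_scope.

Section Bridge.
Variable R : realType.
Local Notation C := R[i].

Lemma complex_archi (x : C) : 0 <= x -> exists k : nat, x <= k%:R.
Proof.
move=> x0; have xr : (complex.Re x)%:C = x by apply: RRe_real; apply: ger0_real.
exists (Num.bound (complex.Re x)).
have -> : (Num.bound (complex.Re x))%:R = ((Num.bound (complex.Re x))%:R)%:C :> C by rewrite rmorph_nat.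
by rewrite -xr lecR ltW //= archi_boundP // -ler0c xr.
Qed.

Lemma l2normE m (x : 'cV[C]_m) : ((l2norm x) ^+ 2)%:C = nsq x.
Proof.
rewrite /l2norm sqr_sqrtr; last by apply: sumr_ge0 => i _; rewrite sqr_ge0.
rewrite nsqE big_ord1 rmorph_sum; apply: eq_bigr => i _.
by rewrite rmorphXn.
Qed.

Lemma l2norm_ge0 m (x : 'cV[C]_m) : 0 <= l2norm x.
Proof. exact: sqrtr_ge0. Qed.

Lemma attains_opnorm m (A : 'M[C]_m) (y : 'cV[C]_m) : attains A y ->
  nsq (A *m y) = ((opnorm A) ^+ 2)%:C * nsq y /\ 0 <= opnorm A.
Proof.
move=> [y0 hy].
have ny0 : 0 < l2norm y.
  rewrite lt_def l2norm_ge0 andbT; apply: contraNneq y0 => e.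
  by rewrite -nsq_eq0 -l2normE e expr0n.
pose r := l2norm (A *m y) / l2norm y.
have r0 : 0 <= r by rewrite divr_ge0 ?l2norm_ge0.
have rE : l2norm (A *m y) = r * l2norm y by rewrite divfK ?gt_eqF.
have bound (x : 'cV[C]_m) : l2norm (A *m x) <= r * l2norm x.
  rewrite -(ler_pM2r ny0) mulrAC -rE.
  rewrite -(@ler_sqr R) ?nnegrE ?mulr_ge0 ?l2norm_ge0 // !exprMn -lecR [leLHS]rmorphM [leRHS]rmorphM /=.
  by rewrite !l2normE.
suff -> : opnorm A = r by split=> //; rewrite -!l2normE -rmorphM -exprMn -rE.
apply/eqP; rewrite eq_le; apply/andP; split.
  apply: ge_sup; first by exists (l2norm (A *m 0)), 0 => //=; rewrite -(@ler_sqr R) ?nnegrE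
    ?l2norm_ge0 // -lecR l2normE nsq0 expr1n ler01.
  move=> _ [x /= x1 <-]; apply: le_trans (bound x) _.
  by rewrite ler_piMr.
apply: ub_le_sup.
  exists r => _ [x /= x1 <-]; apply: le_trans (bound x) _.
  by rewrite ler_piMr.
have nZ (z : 'cV[C]_m) : l2norm ((l2norm y)^-1%:C *: z) = l2norm z / l2norm y.
  apply/eqP; rewrite -(@eqrXn2 _ 2) ?divr_ge0 ?l2norm_ge0 //.
  apply/eqP; apply: (@complexI R); rewrite l2normE nsqZ -l2normE -normrX.
  rewrite exprMn [RHS]rmorphM mulrC. congr (_ * _).
  by rewrite -rmorphXn ger0_norm // ler0c exprn_ge0 // invr_ge0 l2norm_ge0.
exists ((l2norm y)^-1%:C *: y) => /=; first by rewrite nZ divff ?gt_eqF.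
by rewrite -scalemxAr nZ.
Qed.

Lemma opnorm_bound m (A : 'M[C]_m) (x : 'cV[C]_m) : (0 < m)%N ->
  nsq (A *m x) <= ((opnorm A) ^+ 2)%:C * nsq x.
Proof.
move=> m0; have [y hy] := attains_exists A m0.
have [e _] := attains_opnorm hy; have [y0 h] := hy.
have ny : 0 < nsq y by rewrite nsq_gt0.
by rewrite -(ler_pM2r ny) mulrAC -e.
Qed.

Lemma opnorm_ge0 m (A : 'M[C]_m) : (0 < m)%N -> 0 <= opnorm A.
Proof. by move=> m0; have [y /attains_opnorm[]] := attains_exists A m0. Qed.

Variables (k : nat) (n : 'I_k -> nat).
Hypothesis k_gt0 : (0 < k)%N.
Hypothesis n_gt0 : forall i, (0 < n i)%N.
Local Notation blk := (@tagnat.sig1 k n).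
Local Notation D := (@blockdiag C (\sum_i n i)%N _ blk).

Definition emb (a : dsum R n) : 'M[C]_(\sum_i n i) := \mxdiag_i block a i.

Definition diag_blocks (A : 'M[C]_(\sum_i n i)) : dsum R n :=
  mkdsum (fun i => submxblock A i i).

Lemma emb_blockdiag a : D (emb a).
Proof. by move=> s t st; rewrite mxE (negPf st) mxE. Qed.

Lemma embK : cancel emb diag_blocks.
Proof. by move=> a; apply: dsumP => i; rewrite blockE submxblock_diag. Qed.

Lemma diag_blocksK A : D A -> emb (diag_blocks A) = A.
Proof.
move=> DA; rewrite -[RHS]submxblockK; apply/eq_mxblock => i j.
have [<-|ij] := eqVneq i j; first by rewrite conform_mx_id blockE.
apply/matrixP => s t; rewrite !mxE DA //.
by rewrite !tagnat.Rank1K.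
Qed.

Lemma embD : {morph emb : a b / a + b}.
Proof. by move=> a b; rewrite -mxdiagD; apply/eq_mxdiag => i; rewrite blockE. Qed.

Lemma diag_blocksD : {morph diag_blocks : a b / a + b}.
Proof. by move=> a b; apply: dsumP => i; rewrite !blockE submxblockD. Qed.

Lemma emb1 : emb 1 = 1%:M.
Proof. by rewrite -mxdiagZ; apply/eq_mxdiag => i; rewrite blockE. Qed.

Lemma embM : {morph emb : a b / a * b >-> a *m b}.
Proof.
move=> a b; rewrite /emb [X in X *m _]/mxdiag mul_mxblock_mxdiag.
apply/eq_mxblock => i j; have [<-|_] := eqVneq i j; last by rewrite mul0mx.
by rewrite !conform_mx_id blockE.
Qed.

Lemma embZ c a : emb (c *: a) = c *: emb a.
Proof.
transitivity (\mxblock_(i, j) (c *: submxblock (emb a) i j)); last first.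
  by rewrite -[in RHS](submxblockK (emb a)); apply/matrixP => s t; rewrite !mxE.
apply/eq_mxblock => i j; rewrite /emb mxblockK.
by case: eqVneq => [<-|_]; rewrite ?conform_mx_id ?blockE ?scaler0.
Qed.

Lemma map_mxblock p q (p_ : 'I_p -> nat) (q_ : 'I_q -> nat) (f : C -> C)
    (B_ : forall i j, 'M[C]_(p_ i, q_ j)) :
  map_mx f (\mxblock_(i, j) B_ i j) = \mxblock_(i, j) map_mx f (B_ i j).
Proof. by apply/matrixP => s t; rewrite !mxE. Qed.

Lemma emb_star a : emb (star a) = (emb a)^t*.
Proof.
rewrite /emb tr_mxdiag /mxdiag map_mxblock; apply/eq_mxblock => i j.
by case: eqVneq => [<-|_]; rewrite ?conform_mx_id ?blockE ?map_mx0.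
Qed.

Lemma nsq_mxcol (v : forall i, 'cV[C]_(n i)) :
  nsq (\mxcol_i v i) = \sum_i nsq (v i).
Proof.
rewrite /nsq /dot tr_mxcol.
have -> : map_mx Num.conj (\mxrow_i (v i)^T) = \mxrow_i (v i)^t*.
  by apply/matrixP => s t; rewrite !mxE.
by rewrite mul_mxrow_mxcol linear_sum.
Qed.

Lemma emb_mxcol a (v : forall i, 'cV[C]_(n i)) :
  emb a *m \mxcol_i v i = \mxcol_i (block a i *m v i).
Proof. exact: mul_mxdiag_mxcol. Qed.

Lemma cstar_norm_ge0 (a : dsum R n) : 0 <= cstar_norm a.
Proof. exact: bigmax_ge_id. Qed.

Lemma emb_bound a (v : 'cV[C]_(\sum_i n i)) :
  nsq (emb a *m v) <= ((cstar_norm a) ^+ 2)%:C * nsq v.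
Proof.
rewrite -(submxcolK v) emb_mxcol !nsq_mxcol mulr_sumr; apply: ler_sum => i _.
apply: le_trans (opnorm_bound _ _ (n_gt0 i)) _.
rewrite ler_wpM2r ?nsq_ge0 // lecR ler_sqr ?nnegrE ?cstar_norm_ge0 ?opnorm_ge0 //.
exact: (le_bigmax _ (fun i => opnorm (block a i))).
Qed.

(** The largest block norm is attained at a vector supported in that block. *)
Lemma emb_attains a (y : 'cV[C]_(\sum_i n i)) : attains (emb a) y ->
  nsq (emb a *m y) = ((cstar_norm a) ^+ 2)%:C * nsq y.
Proof.
move=> [y0 hy]; apply/eqP; rewrite eq_le emb_bound /=.
have [i _ ei] : {i | xpredT i & cstar_norm a = opnorm (block a i)}.
  by apply: (eq_bigmax (Ordinal k_gt0)) => // i _; apply: opnorm_ge0.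
have [z hz] := attains_exists (block a i) (n_gt0 i).
have [e _] := attains_opnorm hz; have [z0 _] := hz.
have nz : 0 < nsq z by rewrite nsq_gt0.
(* z extended by zero to the other blocks *)
pose v := \mxcol_j (@eqtype.dfwith _ (fun j => 'cV[C]_(n j)) (fun=> 0) i z j).
have nv : nsq v = nsq z.
  rewrite nsq_mxcol (bigD1 i) //= eqtype.dfwith_in big1 ?addr0 // => j ji.
  by rewrite eqtype.dfwith_out 1?eq_sym // nsq0.
have nav : nsq (emb a *m v) = nsq (block a i *m z).
  rewrite emb_mxcol nsq_mxcol (bigD1 i) //= eqtype.dfwith_in big1 ?addr0 // => j ji.
  by rewrite eqtype.dfwith_out 1?eq_sym // mulmx0 nsq0.
have := hy v; rewrite nav nv e -ei mulrAC.
by rewrite ler_pM2r.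
Qed.

(** For the direct implication test orthogonality with c = - e b^* a: by
    [contraction_defect] the norm of a + b c can be as large as that of a only
    at a vector y where b^* a y = 0. The converse is the Cauchy-Schwarz
    inequality for a y and (a + b c) y. *)
Lemma strong_BJ_sorth (a b : dsum R n) : strong_BJ a b <-> sorth (emb a) (emb b).
Proof.
have N0 : (0 < \sum_i n i)%N by rewrite (bigD1 (Ordinal k_gt0)) //= addn_gt0 n_gt0.
set A := emb a; set B := emb b; split; last first.
  move=> [y hy BAy] c; have [y0 _] := hy.
  have ny : 0 < nsq y by rewrite nsq_gt0.
  have sq (r r' : R) : 0 <= r -> 0 <= r' -> (r ^+ 2)%:C <= (r' ^+ 2)%:C -> r <= r'.
    by move=> r0 r'0; rewrite lecR ler_sqr ?nnegrE.
  apply: sq (cstar_norm_ge0 _) (cstar_norm_ge0 _) _; rewrite -(ler_pM2r ny).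
  rewrite -(emb_attains hy); apply: le_trans (emb_bound (a + b * c) y).
  rewrite embD embM -/A -/B; set x := A *m y; set w := (A + _) *m y.
  have xw : nsq x = dot x w.
    by rewrite /w mulmxDl dotDr -mulmxA (dot_mulr B) BAy dot0l addr0.
  have := cauchy_schwarz x w; rewrite -xw (ger0_norm (nsq_ge0 x)) expr2.
  have [->|x0] := eqVneq x 0; first by rewrite nsq0 nsq_ge0.
  have nx : 0 < nsq x by rewrite nsq_gt0.
  by rewrite (ler_pM2l nx).
move=> sbj; pose beta := cstar_norm b ^+ 2.
have beta0 : 0 <= beta by rewrite sqr_ge0.
(* Any e > 0 with e |b|^2 <= 1 will do. *)
pose e : R := (beta + 1)^-1.
have e0 : 0 < e by rewrite invr_gt0 ltr_wpDl.
have eb : e * beta <= 1 by rewrite mulrC ler_pdivrMr ?mul1r ?lerDl ?ler01 ?ltr_wpDl.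
have e0C : 0 < e%:C by rewrite ltcR.
have := sbj (- (e%:C *: (star b * a))).
set c := - _; set a' := a + b * c => le.
have ea' : emb a' = A - e%:C *: (B *m (B^t* *m A)).
  by rewrite /a' embD embM /c -scaleNr embZ embM emb_star -scalemxAr scaleNr.
have [y hy] := attains_exists (emb a') N0; have [y0 _] := hy.
have ny : 0 < nsq y by rewrite nsq_gt0.
pose x := A *m y; pose z := B^t* *m x.
have n1 : nsq (emb a' *m y) <= nsq x - e%:C * nsq z.
  have -> : emb a' *m y = x - e%:C *: (B *m z).
    by rewrite ea' mulmxBl -scalemxAl -!mulmxA.
  apply: contraction_defect e0C _; first exact: (emb_bound b).
  by rewrite -rmorphM -[1](rmorph1 (real_complex R)) lecR.
have n2 : ((cstar_norm a) ^+ 2)%:C * nsq y <= nsq (emb a' *m y).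
  rewrite (emb_attains hy); apply: ler_wpM2r; first exact: nsq_ge0.
  by rewrite lecR (ler_sqr (cstar_norm_ge0 a) (cstar_norm_ge0 a')).
have n3 := emb_bound a y.
have z0 : z = 0.
  apply/eqP; rewrite -nsq_eq0 eq_le nsq_ge0 andbT.
  rewrite -(pmulr_rle0 _ e0C) -oppr_ge0.
  have := le_trans n2 (le_trans n1 _).
  move=> /(_ (((cstar_norm a) ^+ 2)%:C * nsq y - e%:C * nsq z)).
  by rewrite lerBlDr subrK lerDl; apply.
exists y; last exact: z0.
split; [exact: y0 | move=> v; rewrite -/x].
have n4 : ((cstar_norm a) ^+ 2)%:C * nsq y <= nsq x.
  by apply: le_trans n2 (le_trans n1 _); rewrite z0 nsq0 mulr0 subr0.
apply: le_trans (ler_wpM2r (nsq_ge0 y) (emb_bound a v)) _.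
by rewrite mulrAC ler_wpM2r ?nsq_ge0.
Qed.

End Bridge.

(** * The excluded algebras *)

Section Dimension.
Variable R : realType.

Lemma star_isomorphic_refl k (n : 'I_k -> nat) : star_isomorphic R n n.
Proof. by exists idfun; split=> //; exists idfun. Qed.

Lemma dimension_ge3 (k : nat) (n : 'I_k -> nat) :
  (0 < k)%N -> (forall i, (0 < n i)%N) ->
  ~ star_isomorphic R n (fun _ : 'I_1 => 1%N) ->
  ~ star_isomorphic R n (fun _ : 'I_2 => 1%N) ->
  ~ star_isomorphic R n (fun _ : 'I_1 => 2%N) ->
  (2 < \sum_i n i)%N.
Proof.
move=> k0 n0 nC nCC nM2; rewrite ltnNge; apply/negP => N2.
have kN : (k <= 2)%N.
  apply: leq_trans N2; rewrite -{1}[k]card_ord -sum1_card.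
  by apply: leq_sum => i _.
have ext c : (forall i, n i = c) -> n = fun=> c by move=> h; apply/funext.
case: k n k0 n0 nC nCC nM2 N2 kN ext => [|[|[|//]]] // n _ n0 nC nCC nM2 N2 _ ext.
  rewrite big_ord1 in N2; have := n0 ord0.
  case e : (n ord0) N2 => [|[|[|//]]] // _ _.
    by apply: nC; rewrite (ext 1%N) => [|i]; [exact: star_isomorphic_refl | rewrite ord1].
  by apply: nM2; rewrite (ext 2%N) => [|i]; [exact: star_isomorphic_refl | rewrite ord1].
apply: nCC; rewrite (ext 1%N); first exact: star_isomorphic_refl.
rewrite !big_ord_recl big_ord0 addn0 in N2.
have := n0 ord0; have := n0 (lift ord0 ord0) => h1 h2.
have [e0 e1] : n ord0 = 1%N /\ n (lift ord0 ord0) = 1%N.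
  by case: (n ord0) (n (lift ord0 ord0)) h1 h2 N2 => [|[|a]] [|[|b]] //; rewrite ?addnS.
move=> i; case: (unliftP ord0 i) => [j ->|-> //].
by rewrite (ord1 j).
Qed.

End Dimension.

(** * Maps of the standard form are preservers *)

Section Converse.
Variable R : realType.
Local Notation C := R[i].

Lemma opnorm_le m p (A : 'M[C]_m) (B : 'M[C]_p) (g : R) :
  0 <= g -> (0 < m)%N -> (0 < p)%N ->
  (forall v : 'cV[C]_m, exists2 w : 'cV[C]_p,
     nsq (A *m v) = (g ^+ 2)%:C * nsq (B *m w) & nsq w = nsq v) ->
  opnorm A <= g * opnorm B.
Proof.
move=> g0 m0 p0 h; have [y hy] := attains_exists A m0.
have [e _] := attains_opnorm hy; have [y0 _] := hy.
have ny : 0 < nsq y by rewrite nsq_gt0.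
have [w hw nw] := h y.
rewrite -ler_sqr ?nnegrE ?mulr_ge0 ?opnorm_ge0 // -lecR -(ler_pM2r ny) -e hw.
rewrite exprMn [X in _ <= X * _]rmorphM -mulrA -nw ler_wpM2l ?opnorm_bound //.
by rewrite ler0c exprn_ge0.
Qed.

Lemma opnorm_scale m (A : 'M[C]_m) (g : R) : 0 < g -> (0 < m)%N ->
  opnorm (g%:C *: A) = g * opnorm A.
Proof.
move=> g0 m0.
have le (c : R) (B : 'M[C]_m) : 0 < c -> opnorm (c%:C *: B) <= c * opnorm B.
  move=> c0; apply: opnorm_le => //; first exact: ltW.
  move=> v; exists v => //; rewrite -scalemxAl nsqZ.
  by rewrite ger0_norm ?rmorphXn // ler0c ltW.
apply/eqP; rewrite eq_le (le _ _ g0) andTb -(ler_pdivlMl _ _ g0).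
have := @le g^-1 (g%:C *: A); rewrite invr_gt0 scalerA -rmorphM mulVf ?gt_eqF //.
by rewrite rmorph1 scale1r; apply.
Qed.

Lemma opnorm_unitary m (A u v : 'M[C]_m) : (0 < m)%N ->
  u^t* *m u = 1%:M -> v^t* *m v = 1%:M -> opnorm (u *m A *m v) = opnorm A.
Proof.
move=> m0 uu vv.
have le (B u' v' : 'M[C]_m) : u'^t* *m u' = 1%:M -> v'^t* *m v' = 1%:M ->
    opnorm (u' *m B *m v') <= opnorm B.
  move=> hu hv; rewrite -[leRHS]mul1r; apply: opnorm_le => // w.
  exists (v' *m w); last by rewrite nsq_isometry.
  by rewrite expr1n mul1r -!mulmxA nsq_isometry.
apply/eqP; rewrite eq_le (le _ _ _ uu vv) andTb.
have := le (u *m A *m v) (u^t*) (v^t*).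
rewrite !trmxCK (mulmx1C uu) (mulmx1C vv) => /(_ erefl erefl).
by rewrite !mulmxA uu mul1mx -mulmxA (mulmx1C vv) mulmx1.
Qed.

Lemma opnorm_conj m (A : 'M[C]_m) : (0 < m)%N ->
  opnorm (map_mx Num.conj A) = opnorm A.
Proof.
move=> m0.
have cK p q : involutive (map_mx (Num.conj : C -> C) : 'M[C]_(p, q) -> 'M[C]_(p, q)).
  by move=> B; apply/matrixP => i j; rewrite !mxE conjCK.
have nc p q (B : 'M[C]_(p, q)) : nsq (map_mx Num.conj B) = nsq B.
  by rewrite !nsqE; apply: eq_bigr => j _; apply: eq_bigr => i _; rewrite mxE norm_conjC.
have le (B : 'M[C]_m) : opnorm (map_mx Num.conj B) <= opnorm B.
  rewrite -[leRHS]mul1r; apply: opnorm_le => // w.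
  exists (map_mx Num.conj w); last exact: nc.
  by rewrite expr1n mul1r -[in RHS]nc map_mxM cK.
apply/eqP; rewrite eq_le (le A) andTb.
by have := le (map_mx Num.conj A); rewrite cK.
Qed.

Lemma opnorm_castmx m p (e : p = m) (A : 'M[C]_p) : opnorm (castmx (e, e) A) = opnorm A.
Proof. by case: _ / e; rewrite castmx_id. Qed.

Variables (k : nat) (n : 'I_k -> nat).
Hypothesis n_gt0 : forall i, (0 < n i)%N.
Variables (pi : {perm 'I_k}) (dim_pi : forall i, n (pi i) = n i) (S : {set 'I_k}).

Let F a : dsum R n := dagger S (permute dim_pi a).

Lemma dagger_permuteE a i : block (F a) i =
  if i \in S then map_mx Num.conj (castmx (dim_pi i, dim_pi i) (block a (pi i)))
  else castmx (dim_pi i, dim_pi i) (block a (pi i)).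
Proof. by rewrite !blockE. Qed.

Let castmxD m p (e : m = p) (A B : 'M[C]_m) :
  castmx (e, e) (A + B) = castmx (e, e) A + castmx (e, e) B.
Proof. by case: _ / e; rewrite !castmx_id. Qed.

Let castmxM m p (e : m = p) (A B : 'M[C]_m) :
  castmx (e, e) (A *m B) = castmx (e, e) A *m castmx (e, e) B.
Proof. by case: _ / e; rewrite !castmx_id. Qed.

Lemma dagger_permuteD : {morph F : a b / a + b}.
Proof.
move=> a b; apply: dsumP => i; rewrite dagger_permuteE [RHS]blockE !dagger_permuteE.
by rewrite blockE castmxD; case: ifP => _; rewrite ?map_mxD.
Qed.

Lemma dagger_permuteM : {morph F : a b / a * b}.
Proof.
move=> a b; apply: dsumP => i; rewrite dagger_permuteE [RHS]blockE !dagger_permuteE.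
by rewrite blockE castmxM; case: ifP => _; rewrite ?map_mxM.
Qed.

Lemma dagger_permute_surj b : exists a, F a = b.
Proof.
have e i : n (pi^-1%g i) = n i by rewrite -(dim_pi (pi^-1%g i)) permKV.
pose G i : 'M[C]_(n i) := if i \in S then map_mx Num.conj (block b i) else block b i.
exists (mkdsum (fun i => castmx (e i, e i) (G (pi^-1%g i)))).
apply: dsumP => i; rewrite dagger_permuteE blockE.
have -> : castmx (dim_pi i, dim_pi i)
    (castmx (e (pi i), e (pi i)) (G (pi^-1%g (pi i)))) = G i.
  rewrite castmx_comp; move: (etrans _ _); rewrite permK => e1.
  by rewrite (eq_irrelevance e1 erefl) castmx_id.
rewrite /G; case: (i \in S) => //.
by apply/matrixP => s t; rewrite !mxE; apply: conjCK.
Qed.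

Lemma cstar_norm_dagger_permute a : cstar_norm (F a) = cstar_norm a.
Proof.
rewrite /cstar_norm [RHS](reindex_inj (@perm_inj _ pi)); apply: eq_bigr => i _.
rewrite dagger_permuteE; case: ifP => _; last exact: opnorm_castmx.
by rewrite opnorm_conj ?opnorm_castmx.
Qed.

(** Up to the factor g, the map preserves the norm; and Phi a + Phi b c is
    itself a value Phi (a + b c'). *)
Lemma standard_form_preserves (g : R) (u v : dsum R n) (Phi : dsum R n -> dsum R n) :
  0 < g -> unitary u -> unitary v ->
  (forall a, Phi a = g%:C *: (u * F a * v)) ->
  forall a b, strong_BJ a b -> strong_BJ (Phi a) (Phi b).
Proof.
move=> g0 [uu _] [vv v'v] PhiE a b ab c.
have un (w : dsum R n) i : star w * w = 1 -> (block w i)^t* *m block w i = 1%:M.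
  by move/(congr1 (fun z => block z i)); rewrite !blockE.
have nPhi d : cstar_norm (Phi d) = g * cstar_norm d.
  rewrite -(cstar_norm_dagger_permute d) /cstar_norm.
  rewrite (big_morph (fun x => g * x) (id1 := 0) (op1 := Num.max)); last exact: mulr0.
    apply: eq_bigr => i _; rewrite PhiE !blockE (opnorm_scale _ g0 (n_gt0 i)).
    by rewrite (opnorm_unitary _ (n_gt0 i) (un u i uu) (un v i vv)).
  by move=> x y; rewrite maxr_pMr // ltW.
have [c' Fc'] := dagger_permute_surj (v * c * star v).
have -> : Phi a + Phi b * c = Phi (a + b * c').
  rewrite !PhiE dagger_permuteD dagger_permuteM Fc' -dsum_scaleAl -scalerDr.
  by congr (_ *: _); rewrite mulrDr mulrDl -!mulrA vv mulr1.
by rewrite !nPhi ler_pM2l.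
Qed.

End Converse.

(** * Preservers are of the standard form *)

(** The (s, s') entry of X E_mm' X^* is X_sm conj X_s'm', so two columns of X
    belonging to the same block have their supports in a common block. The
    resulting map between blocks is onto, because no row of X vanishes. *)
Lemma unitary_block_permutation (C : numClosedFieldType) (N k : nat)
    (blk : 'I_N -> 'I_k) (X : 'M[C]_N) :
  (forall j, exists s, blk s = j) -> X^t* *m X = 1%:M ->
  (forall s t, blk s = blk t -> blockdiag blk (X *m delta_mx s t *m X^t*)) ->
  exists pi : {perm 'I_k}, forall s m, X s m != 0 -> blk m = pi (blk s).
Proof.
move=> blk_surj XX DX.
have col_neq0 m : exists s, X s m != 0.
  have [/existsP //|/existsPn h] := boolP [exists s, X s m != 0].
  have := congr1 (fun A : 'M_N => A m m) XX; rewrite !mxE eqxx big1.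
    by move/eqP; rewrite eq_sym oner_eq0.
  by move=> s _; have /negPn/eqP -> := h s; rewrite mulr0.
have row_neq0 s : exists m, X s m != 0.
  have [/existsP //|/existsPn h] := boolP [exists m, X s m != 0].
  have := congr1 (fun A : 'M_N => A s s) (mulmx1C XX); rewrite !mxE eqxx big1.
    by move/eqP; rewrite eq_sym oner_eq0.
  by move=> m _; have /negPn/eqP -> := h m; rewrite mul0r.
have same s s' m m' : X s m != 0 -> X s' m' != 0 -> blk m = blk m' -> blk s = blk s'.
  move=> h h' mm'; apply/eqP/negPn/negP => ss'.
  have := DX m m' mm' s s' ss'; rewrite mxE (bigD1 m') //= big1 ?addr0.
    rewrite mxE (bigD1 m) //= big1 ?addr0.
      rewrite !mxE !eqxx mulr1 => /eqP; rewrite mulf_eq0 conjC_eq0.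
      by rewrite (negPf h) (negPf h').
    by move=> l /negPf lm; rewrite mxE lm mulr0.
  move=> l /negPf lm; rewrite mxE big1 ?mul0r // => l' _.
  by rewrite mxE lm andbF mulr0.
have /fin_all_exists [J hJ] : forall i, exists j, forall s m, blk m = i -> X s m != 0 -> blk s = j.
  move=> i; have [m0 m0i] := blk_surj i; have [s0 hs0] := col_neq0 m0.
  by exists (blk s0) => s m mi h; apply: (same _ _ _ _ h hs0); rewrite mi m0i.
have /fin_all_exists [p hp] : forall j, exists i, J i = j.
  move=> j; have [s sj] := blk_surj j; have [m hm] := row_neq0 s.
  by exists (blk m); rewrite -(hJ _ _ _ erefl hm).
exists (perm (can_inj hp)) => s m h; rewrite permE (hJ _ s m erefl h).
by rewrite (canF_sym hp).
Qed.

Section Direct.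
Variable R : realType.
Local Notation C := R[i].
Variables (k : nat) (n : 'I_k -> nat).
Hypothesis k_gt0 : (0 < k)%N.
Hypothesis n_gt0 : forall i, (0 < n i)%N.
Local Notation blk := (@tagnat.sig1 k n).
Local Notation Rank := (@tagnat.Rank k n).
Local Notation N := (\sum_i n i)%N.
Local Notation D := (@blockdiag C N _ blk).

Lemma castmx_conj p q (e : q = p) (U : 'M[C]_(p, q)) (A : 'M[C]_q) :
  castmx (erefl, e) U *m castmx (e, e) A *m (castmx (erefl, e) U)^t* = U *m A *m U^t*.
Proof. by case: _ / e U => U; rewrite !castmx_id. Qed.

Lemma castmx_unitary p q (e : q = p) (U : 'M[C]_(p, q)) :
  U *m U^t* = 1%:M -> castmx (erefl, e) U *m (castmx (erefl, e) U)^t* = 1%:M.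
Proof. by case: _ / e U => U; rewrite !castmx_id. Qed.

Variable Phi : dsum R n -> dsum R n.
Hypothesis N_ge3 : (2 < N)%N.
Hypothesis Phi_additive : {morph Phi : a b / a + b}.
Hypothesis Phi_surjective : forall b, exists a, Phi a = b.
Hypothesis Phi_pres : forall a b,
  mutual_strong_BJ a b -> mutual_strong_BJ (Phi a) (Phi b).

(** The square blocks U i of the unitary X of [core_form] along the
    permutation pi are themselves unitary; comparing the traces of U i U i^*
    and U i^* U i shows that pi respects the dimensions. *)
Lemma preserver_standard_form :
  exists (pi : {perm 'I_k}) (dim_pi : forall i : 'I_k, n (pi i) = n i)
          (gamma : R) (u v : dsum R n) (S : {set 'I_k}),
      [/\ 0 < gamma, unitary u, unitary v
        & forall a : dsum R n,
            Phi a = gamma%:C *: (u * dagger S (permute dim_pi a) * v)].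
Proof.
pose Psi (A : 'M[C]_N) := emb (Phi (diag_blocks A)).
have [X [g [tau [XX g0 GG hX]]]] : exists (X : 'M[C]_N) (g : C) (tau : 'I_k -> bool),
  [/\ X^t* *m X = 1%:M, 0 < g, Psi 1%:M *m (Psi 1%:M)^t* = g%:M &
      forall a, D a -> Psi a = X *m conj_blocks blk tau a *m X^t* *m Psi 1%:M].
  apply: core_form => //.
  - exact: complex_archi.
  - by move=> A B; rewrite /Psi diag_blocksD Phi_additive embD.
  - by move=> A _; apply: emb_blockdiag.
  - move=> B DB; have [a Pa] := Phi_surjective (diag_blocks B).
    by exists (emb a); [apply: emb_blockdiag | rewrite /Psi embK Pa diag_blocksK].
  - move=> A B DA DB AB BA; apply/strong_BJ_sorth => //.
    suff [] : mutual_strong_BJ (Phi (diag_blocks A)) (Phi (diag_blocks B)) by [].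
    by apply: Phi_pres; split; apply/strong_BJ_sorth; rewrite // !diag_blocksK.
have X'X := mulmx1C XX.
pose g1 := Phi 1.
have Psi1 : Psi 1%:M = emb g1 by rewrite /Psi -emb1 embK.
rewrite Psi1 in GG hX.
have {}hX a : emb (Phi a) = X *m conj_blocks blk tau (emb a) *m X^t* *m emb g1.
  by rewrite -hX ?/Psi ?embK //; apply: emb_blockdiag.
have gr : g^* = g by apply/CrealP; apply: gtr0_real.
have gn0 : g != 0 by rewrite gt_eqF.
have DX s t : blk s = blk t -> D (X *m delta_mx s t *m X^t*).
  move=> st; have Dd : D (delta_mx s t) by apply: blockdiag_delta.
  have -> : X *m delta_mx s t *m X^t* =
      g^-1 *: (emb (Phi (diag_blocks (delta_mx s t))) *m (emb g1)^t*).
    rewrite hX diag_blocksK // -(mulmxA _ (emb g1)) GG mul_mx_scalar scalerA mulVf //.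
    rewrite scale1r; congr (_ *m _ *m _); apply/matrixP => a b; rewrite !mxE.
    by case: (_ && _); rewrite ?conj_if0 ?conj_if1.
  by apply: blockdiagZ; apply: blockdiagM; [| apply: blockdiag_adj]; apply: emb_blockdiag.
have blk_surj j : exists s, blk s = j.
  by exists (Rank j (Ordinal (n_gt0 j))); rewrite tagnat.Rank1K.
have [pi hX0] := unitary_block_permutation blk_surj XX DX.
have hpi i j : j != pi i -> submxblock X i j = 0.
  move=> jp; apply/matrixP => a b; rewrite !mxE; apply/eqP.
  by apply: contraNT jp => /hX0; rewrite !tagnat.Rank1K => ->.
pose U i := submxblock X i (pi i).
have eX : X = \mxblock_(i, j) submxblock X i j by rewrite submxblockK.
have eXt : X^t* = \mxblock_(i, j) (submxblock X j i)^t*.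
  by rewrite {1}eX tr_mxblock map_mxblock.
have sub_prod (B : forall i, 'M[C]_(n i)) i :
    submxblock (X *m \mxdiag_j B j *m X^t*) i i = U i *m B (pi i) *m (U i)^t*.
  rewrite {1}eX mul_mxblock_mxdiag eXt mul_mxblock mxblockK (bigD1 (pi i)) //= big1 ?addr0 //.
  by move=> j ji; rewrite hpi // !mul0mx.
have scal (c : C) i : submxblock (c%:M : 'M[C]_N) i i = c%:M.
  by rewrite -mxdiagZ submxblock_diag.
have UU i : U i *m (U i)^t* = 1%:M.
  by have := sub_prod (fun j => 1%:M) i; rewrite mxdiagZ !mulmx1 X'X scal => <-.
have U'U i : (U i)^t* *m U i = 1%:M.
  have h := congr1 (fun A : 'M_N => submxblock A (pi i) (pi i)) XX.
  rewrite /= eXt {2}eX mul_mxblock mxblockK (bigD1 i) //= big1 ?addr0 in h.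
    by rewrite h scal.
  by move=> j ji; rewrite (hpi j) ?mulmx0 // (inj_eq perm_inj) eq_sym.
have dim_pi i : n (pi i) = n i.
  apply/eqP; rewrite -(eqr_nat C) -!mxtrace1 -(UU i) -(U'U i).
  by rewrite mxtrace_mulC.
have conj_diag a : conj_blocks blk tau (emb a) =
    \mxdiag_i (if tau i then map_mx Num.conj (block a i) else block a i).
  apply/matrixP => s t; rewrite /emb /mxdiag !mxE /conj_if.
  case: eqVneq => [e|_]; last by rewrite mxE; case: ifP; rewrite ?conjC0.
  case: (tagnat.sig1 t) / e (tagnat.sig2 t) => t2; rewrite !conform_mx_id.
  by case: ifP; rewrite ?mxE.
pose gamma := Num.sqrt (complex.Re g).
have gE : (complex.Re g)%:C = g by apply: RRe_real; apply: gtr0_real.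
have Rg0 : 0 < complex.Re g by rewrite -ltcR gE.
have gamma0 : 0 < gamma by rewrite sqrtr_gt0.
have gamma2 : (gamma%:C * gamma%:C) = g.
  by rewrite -rmorphM -expr2 sqr_sqrtr ?ltW.
have gammaC0 : gamma%:C != 0 :> C by rewrite gt_eqF // ltcR.
have gammaJ : Num.conj (gamma%:C)^-1 = (gamma%:C)^-1.
  by apply/CrealP; rewrite ger0_real // invr_ge0 ler0c ltW.
pose uu i : 'M[C]_(n i) := castmx (erefl, dim_pi i) (U i).
have uuu i : uu i *m (uu i)^t* = 1%:M by apply: castmx_unitary.
have u'uu i : (uu i)^t* *m uu i = 1%:M by apply: mulmx1C.
have gg i : block g1 i *m (block g1 i)^t* = g%:M.
  have := congr1 (fun A : 'M_N => submxblock A i i) GG.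
  rewrite /= -emb_star -embM submxblock_diag !blockE => ->; exact: scal.
pose vv i : 'M[C]_(n i) := (gamma%:C)^-1 *: ((uu i)^t* *m block g1 i).
have vvv i : vv i *m (vv i)^t* = 1%:M.
  rewrite /vv trmxC_scale trmxC_mul trmxCK -scalemxAl -scalemxAr scalerA gammaJ.
  rewrite mulmxA -(mulmxA _ (block g1 i)) gg mul_mx_scalar -scalemxAl u'uu scalerA.
  by rewrite -invfM gamma2 mulVf // scale1r.
exists pi, dim_pi, gamma, (mkdsum uu), (mkdsum vv), [set i | tau (pi i)].
split=> //.
- split; apply: dsumP => i; rewrite !blockE; [exact: u'uu | exact: uuu].
- split; apply: dsumP => i; rewrite !blockE; [exact: mulmx1C | exact: vvv].
move=> a; apply: dsumP => i.
have -> : block (Phi a) i = submxblock (emb (Phi a)) i i by rewrite submxblock_diag.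
rewrite hX conj_diag; set Z := X *m _ *m X^t*.
have -> : submxblock (Z *m emb g1) i i = submxblock Z i i *m block g1 i.
  by rewrite -{1}(submxblockK Z) /emb mul_mxblock_mxdiag mxblockK.
rewrite sub_prod -(castmx_conj (dim_pi i)) -/(uu i).
rewrite [RHS]blockE [block (_ * _) i]blockE [block (_ * _) i]blockE !(blockE uu) !(blockE vv).
rewrite /vv -scalemxAr scalerA mulfV // scale1r mulmxA; congr (_ *m _ *m _ *m _).
by rewrite dagger_permuteE inE; case: ifP => _ //; rewrite map_castmx.
Qed.

End Direct.

Theorem theorem1p2 (R : realType) (k : nat) (n : 'I_k -> nat)
    (k_gt0 : (0 < k)%N) (n_gt0 : forall i : 'I_k, (0 < n i)%N)
    (not_C : ~ star_isomorphic R n (fun _ : 'I_1 => 1%N))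
    (not_CC : ~ star_isomorphic R n (fun _ : 'I_2 => 1%N))
    (not_M2 : ~ star_isomorphic R n (fun _ : 'I_1 => 2%N))
    (Phi : dsum R n -> dsum R n)
    (Phi_additive : {morph Phi : a b / a + b})
    (Phi_surjective : forall b : dsum R n, exists a : dsum R n, Phi a = b) :
  (forall a b : dsum R n,
      mutual_strong_BJ a b -> mutual_strong_BJ (Phi a) (Phi b))
  <->
  (exists (pi : {perm 'I_k}) (dim_pi : forall i : 'I_k, n (pi i) = n i)
          (gamma : R) (u v : dsum R n) (S : {set 'I_k}),
      [/\ 0 < gamma, unitary u, unitary v
        & forall a : dsum R n,
            Phi a = gamma%:C *: (u * dagger S (permute dim_pi a) * v)]).
Proof.
split=> [pres|[pi [dim_pi [g [u [v [S [g0 uu uv PhiE]]]]]]] a b [ab ba]].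
  apply: preserver_standard_form => //.
  exact: dimension_ge3 k_gt0 n_gt0 not_C not_CC not_M2.
by split; apply: (standard_form_preserves n_gt0 g0 uu uv PhiE).
Qed.
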